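(* Let $m\le d$ be positive integers, let $A\in\mathbb{R}^{d\times d}$ be Hurwitz and $B\in\mathbb{R}^{d\times m}$ be such that $(A,B)$ is controllable, and let $(K^t)_{t\ge 0}$ be the Koopman operators associated with the stochastic differential equation $dX_t = AX_t\,dt + B\,dW_t$. Let $C\in\mathbb{R}^{d\times d}$ be a symmetric positive definite matrix such that $$\tfrac12\big(AC^2+C^2A^\top\big)\le BB^\top .$$ Then the RKHS $\mathbb{H}_C$ is invariant under each Koopman operator $K^t$, $t\ge 0$ (i.e., $K^t f\in\mathbb{H}_C$ for all $f\in\mathbb{H}_C$), and $$\|K^tf\|_C\le e^{t\cdot\operatorname{Tr}(-A)/2}\,\|f\|_C,\qquad f\in\mathbb{H}_C,\ t\ge 0.$$
   Context: All function spaces are real. A matrix $A\in\mathbb{R}^{d\times d}$ is Hurwitz if all its eigenvalues have negative real part. The pair $(A,B)$ is controllable if the matrix $(B,AB,\ldots,A^{d-1}B)$ has full rank $d$. For symmetric matrices, $P\le Q$ means that $Q-P$ is positive semidefinite. $W_t$ is $m$-dimensional Brownian motion and $X_t$ is the solution process of the SDE. The matrix $\Sigma=\int_0^\infty e^{As}BB^\top e^{A^\top s}\,ds$ is positive definite, and the unique stationary distribution of $X_t$ is $$d\mu(x)=(2\pi)^{-d/2}(\det\Sigma)^{-1/2}\exp(-\tfrac12 x^\top\Sigma^{-1}x)\,dx.$$ With $\Sigma(t)=\int_0^t e^{As}BB^\top e^{A^\top s}\,ds$ (positive definite for $t>0$), the Markov transition kernel $\rho_t$ of $X_t$ is, for $t>0$,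 $$\rho_t(x,dy)=(2\pi)^{-d/2}(\det\Sigma(t))^{-1/2}\exp\big(-\tfrac12(y-e^{At}x)^\top\Sigma(t)^{-1}(y-e^{At}x)\big)\,dy,$$ and $\rho_0(x,\cdot)$ is the Dirac measure at $x$. The Koopman operator $K^t:L^2(\mu)\to L^2(\mu)$, $t\ge0$, is $$(K^tf)(x)=\mathbb{E}[f(X_t)\mid X_0=x]=\int_{\mathbb{R}^d}f(y)\,\rho_t(x,dy).$$ For a symmetric positive definite matrix $C\in\mathbb{R}^{d\times d}$, $\mathbb{H}_C$ denotes the reproducing kernel Hilbert space on $\mathbb{R}^d$ generated by the Gaussian kernel $k^C(x,y)=\exp[-(x-y)^\top C^{-2}(x-y)]$, with norm $\|\cdot\|_C$. It is regarded as a subspace of $L^2(\mu)$. *)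

(* Defs.v *)
From HB Require Import structures.
From mathcomp Require Import all_boot all_order all_algebra.
From mathcomp Require Import complex.
From mathcomp Require Import all_classical all_reals all_analysis.
From mathcomp Require Import measurable_realfun.

Set Implicit Arguments.
Unset Strict Implicit.
Unset Printing Implicit Defensive.

Import Order.TTheory GRing.Theory Num.Theory.
Import numFieldNormedType.Exports.

Local Open Scope classical_set_scope.
Local Open Scope ring_scope.

Definition qform (R : realType) (d : nat) (M : 'M[R]_d) (x : 'cV[R]_d) : R :=
  (x^T *m M *m x) 0 0.

Definition possemidef (R : realType) (d : nat) (M : 'M[R]_d) : Prop :=
  M^T = M /\ forall x : 'cV[R]_d, 0 <= qform M x.

Definition posdef (R : realType) (d : nat) (M : 'M[R]_d) : Prop :=
  M^T = M /\ forall x : 'cV[R]_d, x != 0 -> 0 < qform M x.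

Definition loewner_le (R : realType) (d : nat) (P Q : 'M[R]_d) : Prop :=
  possemidef (Q - P).

Definition hurwitz (R : realType) (d : nat) (A : 'M[R]_d) : Prop :=
  forall z : R[i], eigenvalue (map_mx (real_complex R) A) z -> complex.Re z < 0.

(* Rank of the Kalman block matrix (B, AB, ..., A^(d-1) B). *)
Definition controllable (R : realType) (d m : nat)
    (A : 'M[R]_d) (B : 'M[R]_(d, m)) : Prop :=
  \rank (\mxrow_(k < d) (A ^+ k *m B)) = d.

Definition expmx (R : realType) (d : nat) (M : 'M[R]_d) : 'M[R]_d :=
  limn (series (fun k => k`!%:R^-1 *: M ^+ k)).

(* R^d, as column vectors, carries the product sigma-algebra: the one generated
   by the coordinates, as for tuples. *)
Section measurable_cV.
Context {R : realType} (d : nat).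

Definition cV_coord (i : 'I_d) (x : 'cV[R]_d) : R := x i 0.

Let cV_set0 : g_sigma_preimage cV_coord set0.
Proof. exact: sigma_algebra0. Qed.

Let cV_setC A : g_sigma_preimage cV_coord A -> g_sigma_preimage cV_coord (~` A).
Proof. exact: sigma_algebraC. Qed.

Let cV_bigcup (F : (set 'cV[R]_d)^nat) :
  (forall i, g_sigma_preimage cV_coord (F i)) ->
  g_sigma_preimage cV_coord (\bigcup_i (F i)).
Proof. exact: sigma_algebra_bigcup. Qed.

HB.instance Definition _ := @isMeasurable.Build default_measure_display
  'cV[R]_d (g_sigma_preimage cV_coord) cV_set0 cV_setC cV_bigcup.

End measurable_cV.

Section measurable_cV_theory.
Context {R : realType}.

Lemma measurable_cV_coord (d : nat) (i : 'I_d) :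
  measurable_fun [set: 'cV[R]_d] (fun x : 'cV[R]_d => x i 0).
Proof.
move=> _ Y mY; rewrite setTI; apply: sub_sigma_algebra => /=.
rewrite -bigcup_seq/=; exists i => /=; first by rewrite mem_index_enum.
by exists Y => //; rewrite setTI.
Qed.

Lemma measurable_fun_cVP (dT : measure_display) (T : measurableType dT)
    (d : nat) (f : T -> 'cV[R]_d) :
  (forall i, measurable_fun [set: T] (fun x => f x i 0)) ->
  measurable_fun [set: T] f.
Proof.
move=> mf.
have H : g_sigma_preimage (fun i => @cV_coord R d i \o f) `<=` measurable.
  apply: smallest_sub; first exact: sigma_algebra_measurable.
  case: d => [|n] in f mf *; first by rewrite big_ord0.
  rewrite -bigcup_mkord_ord; apply: bigcup_sub => i Ii.
  by move=> A [B mB <-]; exact: mf.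
rewrite g_sigma_preimage_comp in H.
by move=> _ A mA; apply: H; exists A.
Qed.

Definition consV (d : nat) (p : measurableTypeR R * 'cV[R]_d) : 'cV[R]_d.+1 :=
  col_mx (const_mx p.1 : 'cV[R]_1) p.2.

Lemma measurable_consV (d : nat) : measurable_fun setT (@consV d).
Proof.
apply: measurable_fun_cVP => i; have [j ->|j ->] := @split_ordP 1 d i.
  apply: (eq_measurable_fun fst) => [x _|]; last exact: measurable_fst.
  by rewrite /consV (@col_mxEu _ 1 d) mxE.
apply: (eq_measurable_fun (fun x : _ * 'cV[R]_d => x.2 j 0)) => [x _|].
  by rewrite /consV (@col_mxEd _ 1 d).
exact: (measurableT_comp (measurable_cV_coord j) measurable_snd).
Qed.

Definition unconsV (d : nat) (x : 'cV[R]_d.+1) : measurableTypeR R * 'cV[R]_d :=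
  (x 0 0, @dsubmx R 1 d 1 x).

Lemma measurable_unconsV (d : nat) : measurable_fun setT (@unconsV d).
Proof.
apply: measurable_fun_pair; first exact: measurable_cV_coord.
apply: measurable_fun_cVP => i.
apply: (eq_measurable_fun (fun x : 'cV[R]_d.+1 => x (@rshift 1 d i) 0)).
  by move=> x _; rewrite mxE.
exact: measurable_cV_coord.
Qed.

Lemma consVK (d : nat) : cancel (@consV d) (@unconsV d).
Proof.
move=> [a x]; rewrite /unconsV /consV (@col_mxKd R 1 d 1); congr (_, _).
have -> : (0 : 'I_d.+1) = @lshift 1 d 0 by apply/val_inj.
by rewrite (@col_mxEu _ 1 d) mxE.
Qed.

End measurable_cV_theory.

Section lebesgue_cV.
Context {R : realType}.

HB.instance Definition _ (d : nat) :=
  @isMeasurableFun.Build _ _ (measurableTypeR R * 'cV[R]_d)%type 'cV[R]_d.+1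
    (@consV R d) (@measurable_consV R d).

Definition lebesgue_cons (d : nat)
    (mu : {sigma_finite_measure set 'cV[R]_d -> \bar R}) :
    set 'cV[R]_d.+1 -> \bar R :=
  pushforward (@lebesgue_measure R \x mu)%E (@consV R d).

Section lebesgue_cons.
Variables (d : nat) (mu : {sigma_finite_measure set 'cV[R]_d -> \bar R}).

Let lebesgue_cons0 : lebesgue_cons mu set0 = 0%E.
Proof. exact: measure0. Qed.

Let lebesgue_cons_ge0 V : (0 <= lebesgue_cons mu V)%E.
Proof. exact: measure_ge0. Qed.

Let lebesgue_cons_sigma_additive : semi_sigma_additive (lebesgue_cons mu).
Proof. exact: measure_semi_sigma_additive. Qed.

HB.instance Definition _ := isMeasure.Build _ _ _ (lebesgue_cons mu)
  lebesgue_cons0 lebesgue_cons_ge0 lebesgue_cons_sigma_additive.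

Let lebesgue_cons_sigma_finite : sigma_finite setT (lebesgue_cons mu).
Proof.
have /sigma_finiteP[F [TF ndF Foo]] := sigma_finiteT (@lebesgue_measure R).
have /sigma_finiteP[G [TG ndG Goo]] := sigma_finiteT mu.
exists (fun n => @unconsV R d @^-1` (F n `*` G n)).
  rewrite -preimage_bigcup; apply/esym; rewrite -subTset => x _ /=.
  have [n _ Fn] : (\bigcup_i F i) (unconsV x).1 by rewrite -TF.
  have [k _ Gk] : (\bigcup_i G i) (unconsV x).2 by rewrite -TG.
  exists (maxn n k) => //; split.
    by move: Fn; exact/subsetPset/ndF/leq_maxl.
  by move: Gk; exact/subsetPset/ndG/leq_maxr.
move=> n; have [mF F_oo] := Foo n; have [mG G_oo] := Goo n; split.
  rewrite -[X in measurable X]setTI; apply: measurable_unconsV => //.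
  exact: measurableX.
rewrite /lebesgue_cons /pushforward -comp_preimage.
rewrite (_ : _ \o _ = id); last by apply/funext => p /=; rewrite consVK.
by rewrite preimage_id product_measure1E// lte_mul_pinfty// ge0_fin_numE.
Qed.

HB.instance Definition _ := Measure_isSigmaFinite.Build _ _ _
  (lebesgue_cons mu) lebesgue_cons_sigma_finite.

End lebesgue_cons.

(* d-dimensional Lebesgue measure: the d-fold product of lebesgue_measure, moved
   from R * R^d to R^(d+1) by consV; on the one-point space R^0 it has mass 1. *)
Fixpoint lebesgue_cV (d : nat) :
    {sigma_finite_measure set 'cV[R]_d -> \bar R} :=
  if d is d'.+1 then lebesgue_cons (lebesgue_cV d') else \d_(0 : 'cV[R]_0).

End lebesgue_cV.

Section gauss.
Context {R : realType} (d : nat).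
Implicit Types (a : 'cV[R]_d) (S : 'M[R]_d).

(* Meaningful for S positive definite only. *)
Definition gauss_pdf a S (x : 'cV[R]_d) : R :=
  (2 * pi) `^ (- (d%:R / 2)) * (\det S) `^ (- 2^-1)
  * expR (- (2^-1 * qform (invmx S) (x - a))).

Lemma gauss_pdf_ge0 a S x : 0 <= gauss_pdf a S x.
Proof. by rewrite !mulr_ge0 ?powR_ge0 ?expR_ge0. Qed.

Lemma measurable_gauss_pdf a S : measurable_fun setT (gauss_pdf a S).
Proof.
apply: measurable_funM => //; apply: measurableT_comp => //.
apply: measurableT_comp => //; apply: measurable_funM => //.
have mc i : measurable_fun setT (fun x : 'cV[R]_d => (x - a) i 0).
  apply: (eq_measurable_fun (fun x : 'cV[R]_d => x i 0 - a i 0)).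
    by move=> x _; rewrite !mxE.
  by apply: measurable_funB => //; exact: measurable_cV_coord.
apply: (eq_measurable_fun (fun x : 'cV[R]_d =>
  \sum_j (\sum_i (x - a) i 0 * invmx S i j) * (x - a) j 0)).
  move=> x _; rewrite /qform mxE; apply: eq_bigr => j _; congr (_ * _).
  by rewrite mxE; apply: eq_bigr => i _; rewrite [in RHS]mxE.
apply: measurable_sum => j; apply: measurable_funM => //.
by apply: measurable_sum => i; exact: measurable_funM.
Qed.

Definition gauss_measure a S (V : set 'cV[R]_d) : \bar R :=
  (\int[lebesgue_cV d]_(x in V) (gauss_pdf a S x)%:E)%E.

Section gauss_measure.
Variables (a : 'cV[R]_d) (S : 'M[R]_d).

Let gauss_measure0 : gauss_measure a S set0 = 0%E.
Proof. by rewrite /gauss_measure integral_set0. Qed.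

Let gauss_measure_ge0 V : (0 <= gauss_measure a S V)%E.
Proof. by apply: integral_ge0 => x _; rewrite lee_fin gauss_pdf_ge0. Qed.

Let gauss_measure_sigma_additive : semi_sigma_additive (gauss_measure a S).
Proof.
move=> F mF tF mUF; rewrite /gauss_measure ge0_integral_bigcup//=.
- apply: is_cvg_ereal_nneg_natsum_cond => n _ _.
  by apply: integral_ge0 => x _; rewrite lee_fin gauss_pdf_ge0.
- by apply/measurable_EFinP; apply: measurable_funTS; exact: measurable_gauss_pdf.
- by move=> x _; rewrite lee_fin gauss_pdf_ge0.
Qed.

HB.instance Definition _ := isMeasure.Build _ _ _ (gauss_measure a S)
  gauss_measure0 gauss_measure_ge0 gauss_measure_sigma_additive.

End gauss_measure.
End gauss.

(* The solution of dX_t = A X_t dt + B dW_t enters only through its explicit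
   Gaussian transition kernel (transition) and stationary law (stationary). *)
Section ornstein_uhlenbeck.
Context {R : realType} (d m : nat).
Variables (A : 'M[R]_d) (B : 'M[R]_(d, m)).

Definition cov_integral (D : set R) : 'M[R]_d :=
  \matrix_(i, j) \int[lebesgue_measure]_(s in D)
    (expmx (s *: A) *m B *m B^T *m expmx (s *: A^T)) i j.

Definition Sigma_t (t : R) : 'M[R]_d := cov_integral `[0, t].

Definition Sigma : 'M[R]_d := cov_integral `[0, +oo[.

Definition stationary : {measure set 'cV[R]_d -> \bar R} :=
  gauss_measure 0 Sigma.

Definition transition (t : R) (x : 'cV[R]_d) :
    {measure set 'cV[R]_d -> \bar R} :=
  if t == 0 then (\d_x : {measure set 'cV[R]_d -> \bar R})
  else gauss_measure (expmx (t *: A) *m x) (Sigma_t t).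

(* E[f(X_t) | X_0 = x]; f is an actual function, not a class modulo
   stationary-a.e. equality. *)
Definition koopman (t : R) (f : 'cV[R]_d -> R) (x : 'cV[R]_d) : R :=
  \int[transition t x]_y f y.

End ornstein_uhlenbeck.

Section rkhs.
Context {R : realType} (X : Type).
Implicit Types (H : set (X -> R)) (ip : (X -> R) -> (X -> R) -> R).

Definition ip_norm ip (f : X -> R) : R := Num.sqrt (ip f f).

(* The set H of functions on X, with the inner product ip, is a Hilbert space
   with reproducing kernel k. By Moore-Aronszajn a positive definite symmetric
   k determines H, and ip on H; the values of ip outside H are irrelevant. *)
Record is_rkhs (k : X -> X -> R) H ip : Prop := IsRkhs {
  rkhs0 : H (fun=> 0) ;
  rkhsD : forall f g, H f -> H g -> H (f \+ g) ;
  rkhsZ : forall (c : R) f, H f -> H (c \*o f) ;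
  rkhs_ipC : forall f g, H f -> H g -> ip f g = ip g f ;
  rkhs_ipDl : forall f g h, H f -> H g -> H h ->
    ip (f \+ g) h = ip f h + ip g h ;
  rkhs_ipZl : forall (c : R) f g, H f -> H g -> ip (c \*o f) g = c * ip f g ;
  rkhs_ip_ge0 : forall f, H f -> 0 <= ip f f ;
  rkhs_ip_eq0 : forall f, H f -> ip f f = 0 -> f = (fun=> 0) ;
  rkhs_complete : forall u : nat -> X -> R, (forall n, H (u n)) ->
    (forall e, 0 < e -> exists N, forall i j, (N <= i)%N -> (N <= j)%N ->
       ip_norm ip (u i \- u j) < e) ->
    exists2 f, H f & ip_norm ip (u n \- f) @[n --> \oo] --> (0 : R) ;
  rkhs_kernel : forall x, H (k x) ;
  rkhs_reproducing : forall f x, H f -> ip f (k x) = f x }.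

End rkhs.

(* C^-2 is the inverse of C ^+ 2. *)
Definition gauss_kernel (R : realType) (d : nat) (C : 'M[R]_d)
    (x y : 'cV[R]_d) : R :=
  expR (- qform (invmx (C ^+ 2)) (x - y)).

(* Main.v *)
Require Import Defs.
From mathcomp Require Import all_boot all_order all_algebra.
From mathcomp Require Import all_classical all_reals all_analysis.
From mathcomp Require Import measurable_realfun.
From mathcomp Require Import ring lra.

(** Write M = e^{tA}, S = Sigma_t, V = C^2 / 2 and let g_W be the centred Gaussian
    density of covariance W. The kernel is k(x, y) = c g_V(x - y) for a constant c,
    and K^t f (x) = E f(Mx + Z) with Z of law N(0, S).

    On the space H, f |-> E f(Mx + Z) is a bounded functional, with a Riesz
    representer phi_x. Since Gaussian densities are stable under convolution
    (gauss_pdf_convolution), the Gram matrix of these representers is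
    <phi_x, phi_y> = c g_{V+2S}(Mx - My) = (det M)^-1 c g_Q(x - y), where
    Q = M^-1 (V + 2S) M^-T, and det M = e^{t tr A} by Liouville's formula
    (det_expmx).

    The hypothesis on C, integrated along the flow (lyapunov_integrated), says that
    M C^2 M^T <= C^2 + 2S. Hence U = Q - V is positive definite, and g_Q is the
    convolution of g_V with the density of N(0, U). A quadratic form of g_V
    decreases under averaging over translations: with psi in the span of the
    kernel sections and psi_u its translate, <psi, psi_u> <= |psi| |psi_u| = |psi|^2
    (gauss_kernel_smoothing_le). The Gram matrix of the phi_x is therefore at most
    (det M)^-1 times that of the kernel sections.

    Consequently |sum_i c_i K^t f(x_i)| = |<f, sum_i c_i phi_{x_i}>| is at most
    (det M)^{-1/2} |f| |sum_i c_i k(x_i, .)|, and a function with such a bound is in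
    H with the corresponding norm, again by Riesz representation (rkhs_mem). As
    (det M)^{-1/2} = e^{t tr(-A) / 2}, this is the claim.

    This is for t > 0 and S invertible. For t = 0 the operator is the identity, and if
    S is singular the density formula is zero, and K^t f with it.

    The statement on classes modulo the stationary law reduces to the pointwise one:
    for t > 0 a transition law does not charge the null sets of Lebesgue measure. *)

Set Implicit Arguments.
Unset Strict Implicit.
Unset Printing Implicit Defensive.

Import Order.TTheory GRing.Theory Num.Theory.
Import numFieldNormedType.Exports.

Local Open Scope classical_set_scope.
Local Open Scope ring_scope.

(** * Hilbert spaces with a reproducing kernel *)

Section rkhs_theory.
Context {R : realType} (X : Type).
Variables (k : X -> X -> R) (H : set (X -> R)) (ip : (X -> R) -> (X -> R) -> R).
Hypothesis HR : is_rkhs k H ip.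
Implicit Types (f g h : X -> R).
Local Notation nrm := (ip_norm ip).

Lemma ip_norm_ge0 f : 0 <= nrm f.
Proof. exact: sqrtr_ge0. Qed.

Lemma sqr_ip_norm f : H f -> nrm f ^+ 2 = ip f f.
Proof. by move=> Hf; rewrite sqr_sqrtr// (rkhs_ip_ge0 HR). Qed.

Lemma rkhs_scaleD c f g : H f -> H g -> H (f \+ c \*o g).
Proof. by move=> Hf Hg; apply: (rkhsD HR) => //; exact: (rkhsZ HR). Qed.

Lemma rkhs_subE f g : f \- g = f \+ (-1) \*o g.
Proof. by apply/funext => x /=; rewrite mulN1r. Qed.

Lemma rkhsB f g : H f -> H g -> H (f \- g).
Proof. by move=> Hf Hg; rewrite rkhs_subE; exact: rkhs_scaleD. Qed.

Lemma ip_linl c f g h : H f -> H g -> H h ->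
  ip (f \+ c \*o g) h = ip f h + c * ip g h.
Proof.
move=> Hf Hg Hh; rewrite (rkhs_ipDl HR)//; last exact: (rkhsZ HR).
by rewrite (rkhs_ipZl HR).
Qed.

Lemma ip_linr c f g h : H f -> H g -> H h ->
  ip h (f \+ c \*o g) = ip h f + c * ip h g.
Proof.
move=> Hf Hg Hh; rewrite (rkhs_ipC HR)//; last exact: rkhs_scaleD.
by rewrite ip_linl// !(rkhs_ipC HR Hh).
Qed.

Lemma ipBl f g h : H f -> H g -> H h -> ip (f \- g) h = ip f h - ip g h.
Proof. by move=> *; rewrite rkhs_subE ip_linl// mulN1r. Qed.

Lemma ip_quad c f g : H f -> H g ->
  ip (f \+ c \*o g) (f \+ c \*o g) = ip f f + 2 * c * ip f g + c ^+ 2 * ip g g.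
Proof.
move=> Hf Hg; rewrite ip_linl ?ip_linr//; last exact: rkhs_scaleD.
rewrite (rkhs_ipC HR Hg Hf); ring.
Qed.

Lemma ip_cauchy_schwarz f g : H f -> H g -> ip f g <= nrm f * nrm g.
Proof.
move=> Hf Hg.
have nf := sqr_ip_norm Hf; have ng := sqr_ip_norm Hg.
have nf0 := ip_norm_ge0 f; have ng0 := ip_norm_ge0 g.
have q c : 0 <= nrm f ^+ 2 + 2 * c * ip f g + c ^+ 2 * nrm g ^+ 2.
  by rewrite nf ng -ip_quad// (rkhs_ip_ge0 HR)//; exact: rkhs_scaleD.
have [g0|g0] := eqVneq (nrm g) 0.
  rewrite g0 mulr0 leNgt; apply/negP => fg0.
  have := q (- (nrm f ^+ 2 + 1) / (2 * ip f g)).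
  rewrite g0 expr0n/= mulr0 addr0 (_ : 2 * _ * _ = - (nrm f ^+ 2 + 1)); first lra.
  by field; lra.
have {}g0 : 0 < nrm g by rewrite lt_neqAle eq_sym g0.
(* the value of c at which |f + c g| would vanish if equality held *)
have := q (- (nrm f / nrm g)).
have -> : nrm f ^+ 2 + 2 * (- (nrm f / nrm g)) * ip f g
    + (- (nrm f / nrm g)) ^+ 2 * nrm g ^+ 2
  = 2 * (nrm f / nrm g) * (nrm f * nrm g - ip f g) by field; lra.
have [f0|f0] := eqVneq (nrm f) 0; last first.
  by rewrite pmulr_rge0 ?subr_ge0// mulr_gt0// divr_gt0// lt_neqAle eq_sym f0.
move=> _; rewrite f0 mul0r leNgt; apply/negP => fg0.
have := q (- (ip f g / nrm g ^+ 2)).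
rewrite f0.
have -> : 0 ^+ 2 + 2 * (- (ip f g / nrm g ^+ 2)) * ip f g
    + (- (ip f g / nrm g ^+ 2)) ^+ 2 * nrm g ^+ 2 = - (ip f g / nrm g) ^+ 2.
  by field; lra.
by apply/negP; rewrite -ltNge oppr_lt0 exprn_gt0// divr_gt0.
Qed.

Lemma ip_abs_le f g : H f -> H g -> `|ip f g| <= nrm f * nrm g.
Proof.
move=> Hf Hg; rewrite ler_norml ip_cauchy_schwarz// andbT lerNl.
have := ip_cauchy_schwarz (rkhsZ HR (-1) Hf) Hg.
rewrite (rkhs_ipZl HR)// mulN1r; congr (_ <= _ * _).
rewrite /ip_norm (rkhs_ipZl HR)//; last exact: (rkhsZ HR).
rewrite (rkhs_ipC HR)//; last exact: (rkhsZ HR).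
by rewrite (rkhs_ipZl HR)// mulrA mulrNN !mul1r.
Qed.

Lemma rkhs_eval_le f x : H f -> `|f x| <= nrm f * Num.sqrt (k x x).
Proof.
move=> Hf; rewrite -(rkhs_reproducing HR x Hf).
apply: (le_trans (ip_abs_le Hf (rkhs_kernel HR x))).
by rewrite {2}/ip_norm (rkhs_reproducing HR)//; exact: (rkhs_kernel HR).
Qed.

Lemma ip_norm_triangle f g : H f -> H g -> nrm (f \+ g) <= nrm f + nrm g.
Proof.
move=> Hf Hg; rewrite -(@ler_pXn2r _ 2)// ?nnegrE ?addr_ge0 ?ip_norm_ge0//.
rewrite sqr_ip_norm; last exact: (rkhsD HR).
have -> : f \+ g = f \+ 1 \*o g by apply/funext => x /=; rewrite mul1r.
rewrite ip_quad// sqrrD !sqr_ip_norm//.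
have := ip_cauchy_schwarz Hf Hg; lra.
Qed.

(** Riesz representation for a functional given by its graph, a linear relation
    between functions and scalars, so that the functional may be defined on a
    subspace only and by way of non-unique presentations of its elements. A
    minimizing sequence of v |-> |v|^2 - 2 l(v) is Cauchy by the parallelogram
    identity and its limit represents l. *)
Lemma riesz_relation (G : (X -> R) -> R -> Prop) (K : R) : 0 <= K ->
  G (fun=> 0) 0 ->
  (forall c u v a b, G u a -> G v b -> G (u \+ c \*o v) (a + c * b)) ->
  (forall u a, G u a -> H u) ->
  (forall u a, G u a -> `|a| <= K * nrm u) ->
  exists g, [/\ H g, nrm g <= K, (forall u a, G u a -> ip g u = a) &
    exists v : nat -> X -> R, (forall n, exists a, G (v n) a) /\
      (nrm (v n \- g) @[n --> \oo] --> (0 : R))].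
Proof.
move=> K0 G0 Glin GH GK.
pose J (p : (X -> R) * R) := nrm p.1 ^+ 2 - 2 * p.2.
pose D : set ((X -> R) * R) := [set p | G p.1 p.2].
pose L c (p q : (X -> R) * R) := (p.1 \+ c \*o q.1, p.2 + c * q.2).
have DH p : D p -> H p.1 by exact: GH.
have DL c p q : D p -> D q -> D (L c p q) by move=> Dp Dq; exact: Glin.
have JL c p q : D p -> D q ->
    J (L c p q) = J p + 2 * c * (ip p.1 q.1 - q.2) + c ^+ 2 * nrm q.1 ^+ 2.
  move=> Dp Dq; rewrite /J /= sqr_ip_norm; last by apply: rkhs_scaleD; exact: DH.
  have Hp := DH _ Dp; have Hq := DH _ Dq.
  by rewrite ip_quad// !sqr_ip_norm//; ring.
have lbJ : has_lbound (J @` D).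
  exists (- K ^+ 2) => _ [p Dp <-].
  have := GK _ _ Dp; rewrite ler_norml => /andP[_ h].
  rewrite /J; have := ip_norm_ge0 p.1; have := sqr_ge0 (nrm p.1 - K).
  by rewrite sqrrB; nra.
have infJ : has_inf (J @` D).
  by split=> //; exists (J (fun=> 0, 0)); exists (fun=> 0, 0).
set I := inf (J @` D).
have IJ p : D p -> I <= J p by move=> Dp; apply: ge_inf => //; exists p.
have [P DP] : {P : nat -> (X -> R) * R &
    forall n, D (P n) /\ J (P n) < I + n.+1%:R^-1}.
  apply: (@choice _ _ (fun n p => D p /\ J p < I + n.+1%:R^-1)) => n.
  have n0 : 0 < n.+1%:R^-1 :> R by rewrite invr_gt0.
  by have [_ [p Dp <-] h] := inf_adherent n0 infJ; exists p.
(* The optimal step from P n along q lowers J by dl^2 / N, while J (P n) is within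
   1/(n+1) of the infimum. *)
have near_ortho n q : D q ->
    (ip (P n).1 q.1 - q.2) ^+ 2 <= n.+1%:R^-1 * (nrm q.1 ^+ 2 + 1).
  move=> Dq; have [Dp Jp] := DP n.
  set N := nrm q.1 ^+ 2 + 1; set dl := _ - _.
  have N0 : 0 < N by rewrite ltr_wpDl// sqr_ge0.
  have := IJ _ (DL (- (dl / N)) _ _ Dp Dq); rewrite JL// -/dl.
  have -> : nrm q.1 ^+ 2 = N - 1 by rewrite /N addrK.
  have -> : J (P n) + 2 * - (dl / N) * dl + (- (dl / N)) ^+ 2 * (N - 1)
    = J (P n) - dl ^+ 2 / N - (dl / N) ^+ 2 by field; lra.
  rewrite -ler_pdivrMr//; have := sqr_ge0 (dl / N).
  move: (J (P n)) (n.+1%:R^-1) (dl ^+ 2 / N) ((dl / N) ^+ 2) Jp => a b c e; lra.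
(* parallelogram identity at the midpoint of P i and P j *)
have cauchyP i j : nrm ((P i).1 \- (P j).1) ^+ 2 <= 2 * (i.+1%:R^-1 + j.+1%:R^-1).
  have [Di Ji] := DP i; have [Dj Jj] := DP j.
  pose r := L (-1) (P i) (P j); have Dr : D r by exact: DL.
  have -> : (P i).1 \- (P j).1 = r.1 by rewrite rkhs_subE.
  have := IJ _ (DL 2^-1 _ _ Dj Dr); have := JL 2^-1 _ _ Dj Dr.
  have := JL 1 _ _ Dj Dr.
  have -> : L 1 (P j) r = P i.
    rewrite /L /r /L [RHS]surjective_pairing; congr (_, _); last by rewrite /=; ring.
    by apply/funext => x /=; ring.
  move=> e1 ->; move: e1 Ji Jj; rewrite expr1n mul1r mulr1.
  move: (J (P i)) (J (P j)) (i.+1%:R^-1) (j.+1%:R^-1) (ip _ _ - _) (nrm _ ^+ 2).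
  by move=> *; lra.
have [||g Hg vg] := rkhs_complete HR (u := fun n => (P n).1).
- by move=> n; exact: DH (DP n).1.
- move=> e e0.
  have [N hN] : exists N : nat, forall i, (N <= i)%N -> i.+1%:R^-1 < e ^+ 2 / 4.
    have e40 : 0 < e ^+ 2 / 4 by rewrite divr_gt0// exprn_gt0.
    have [N _ hN] := near_infty_natSinv_lt (PosNum e40).
    by exists N => i; exact: hN.
  exists N => i j Ni Nj; rewrite -(@ltr_pXn2r _ 2)// ?nnegrE ?ip_norm_ge0 ?(ltW e0)//.
  apply: (le_lt_trans (cauchyP i j)).
  have := hN i Ni; have := hN j Nj.
  by move: (i.+1%:R^-1) (j.+1%:R^-1) (e ^+ 2) => *; lra.
exists g.
have small e : 0 < e -> exists n, n.+1%:R^-1 <= e /\ nrm ((P n).1 \- g) <= e.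
  move=> e0; have [N1 _ h1] := near_infty_natSinv_lt (PosNum e0).
  have [N2 _ h2] := (@cvgrPdist_lt _ R^o _ _ _ _ _).1 vg _ e0.
  exists (maxn N1 N2); split; first by apply/ltW/h1; exact: leq_maxl.
  have := h2 (maxn N1 N2) (leq_maxr _ _).
  by rewrite sub0r normrN ger0_norm ?ip_norm_ge0// => /ltW.
have rep u a : G u a -> ip g u = a.
  move=> Gu; apply/eqP; rewrite -subr_eq0 -normr_le0; apply/ler_addgt0Pr => e e0; rewrite add0r.
  have Hu := GH _ _ Gu; have u0 := ip_norm_ge0 u.
  pose N := nrm u ^+ 2 + 1; have N0 : 0 < N by rewrite ltr_wpDl// sqr_ge0.
  pose e1 := Num.min ((e / 2) ^+ 2 / N) (e / (2 * (nrm u + 1))).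
  have e10 : 0 < e1.
    by rewrite lt_min !divr_gt0 ?exprn_gt0 ?divr_gt0 ?mulr_gt0// ltr_wpDl.
  have [n [n1 n2]] := small e1 e10; have Dp := (DP n).1.
  have -> : ip g u - a = (ip (P n).1 u - a) - ip ((P n).1 \- g) u.
    by rewrite ipBl//; [ring|exact: DH].
  apply: (le_trans (ler_normB _ _)); rewrite [e]splitr lerD//.
    rewrite -(@ler_pXn2r _ 2)// ?nnegrE ?divr_ge0 ?(ltW e0)// real_normK ?num_real//.
    apply: (le_trans (near_ortho n (u, a) Gu)); rewrite -ler_pdivlMr//.
    by apply: (le_trans n1); rewrite ge_min lexx.
  apply: (le_trans (ip_abs_le (rkhsB (DH _ Dp) Hg) Hu)).
  apply: (@le_trans _ _ (e / (2 * (nrm u + 1)) * nrm u)).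
    by apply: ler_wpM2r => //; apply: (le_trans n2); rewrite ge_min lexx orbT.
  rewrite -mulrA ler_wpM2l ?(ltW e0)// mulrC ler_pdivrMr; last lra.
  by lra.
split=> //; last first.
  by exists (fun n => (P n).1); split=> // n; exists (P n).2; exact: (DP n).1.
have g0 := ip_norm_ge0 g.
have [->//|gN0] := eqVneq (nrm g) 0.
have gp : 0 < nrm g by rewrite lt_neqAle eq_sym gN0.
rewrite -(ler_pM2r gp) -expr2; apply/ler_addgt0Pr => e e0.
have [|n [_ nn]] := small (e / (K + nrm g)); first by rewrite divr_gt0// ltr_wpDl.
have Dp := (DP n).1; have HP := DH _ Dp.
rewrite sqr_ip_norm//.
have -> : ip g g = ip g (P n).1 - ip ((P n).1 \- g) g.
  by rewrite ipBl// (rkhs_ipC HR Hg HP); ring.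
rewrite (rep _ _ Dp).
have h1 := GK _ _ Dp.
have h2 := ip_abs_le (rkhsB HP Hg) Hg.
have h3 : nrm (P n).1 <= nrm g + nrm ((P n).1 \- g).
  have {1}-> : (P n).1 = g \+ ((P n).1 \- g) by apply/funext => x /=; ring.
  by apply: ip_norm_triangle => //; exact: rkhsB.
move: nn; rewrite ler_pdivlMr; last by rewrite ltr_wpDl.
have := ler_norm (P n).2; have := ler_norm (- ip ((P n).1 \- g) g).
by rewrite normrN; nra.
Qed.
End rkhs_theory.

Section kernel_combinations.
Context {R : realType} (X : Type).
Implicit Types (f : X -> R).

(** The lists s are presentations, not necessarily unique, of the elements of the
    span of the family phi. *)
Definition comb (I : Type) (phi : I -> X -> R) (s : seq (R * I)) : X -> R :=
  fun y => \sum_(p <- s) p.1 * phi p.2 y.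

Variables (k : X -> X -> R) (H : set (X -> R)) (ip : (X -> R) -> (X -> R) -> R).
Hypothesis HR : is_rkhs k H ip.
Local Notation nrm := (ip_norm ip).

Section families.
Variables (I : Type) (phi : I -> X -> R).
Implicit Types s : seq (R * I).

Lemma comb_cons p s : comb phi (p :: s) = comb phi s \+ p.1 \*o phi p.2.
Proof. by apply/funext => y; rewrite /comb big_cons addrC. Qed.

Lemma comb_linear c s s' :
  comb phi (s ++ [seq (c * p.1, p.2) | p <- s']) = comb phi s \+ c \*o comb phi s'.
Proof.
apply/funext => y; rewrite /comb big_cat/= big_map mulr_sumr.
by congr (_ + _); apply: eq_bigr => p _; rewrite mulrA.
Qed.

Hypothesis Hphi : forall i, H (phi i).

Lemma rkhs_comb s : H (comb phi s).
Proof.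
elim: s => [|p s IH].
  rewrite (_ : comb phi [::] = fun=> 0); first exact: (rkhs0 HR).
  by apply/funext => y; rewrite /comb big_nil.
by rewrite comb_cons; exact: (rkhs_scaleD HR).
Qed.

Lemma ip_comb f s : H f -> ip f (comb phi s) = \sum_(p <- s) p.1 * ip f (phi p.2).
Proof.
move=> Hf; elim: s => [|p s IH].
  rewrite big_nil (_ : comb phi [::] = 0 \*o f); last first.
    by apply/funext => y; rewrite /comb big_nil/= mul0r.
  by rewrite (rkhs_ipC HR)// ?(rkhs_ipZl HR) ?mul0r//; exact: (rkhsZ HR).
by rewrite comb_cons (ip_linr HR) ?IH ?big_cons 1?addrC//; exact: rkhs_comb.
Qed.

Lemma sqr_norm_comb s : nrm (comb phi s) ^+ 2
  = \sum_(p <- s) \sum_(q <- s) p.1 * q.1 * ip (phi p.2) (phi q.2).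
Proof.
have Hc := rkhs_comb s.
rewrite (sqr_ip_norm HR Hc) ip_comb//; apply: eq_bigr => p _.
rewrite (rkhs_ipC HR)// ip_comb// mulr_sumr; apply: eq_bigr => q _.
by rewrite mulrA.
Qed.

End families.

Let Hk := rkhs_kernel HR.

Lemma ip_kernel_comb f (s : seq (R * X)) : H f ->
  ip f (comb k s) = \sum_(p <- s) p.1 * f p.2.
Proof.
move=> Hf; rewrite ip_comb//; apply: eq_bigr => p _.
by rewrite (rkhs_reproducing HR).
Qed.

(* The graph of v |-> sum_i c_i F(x_i) on combinations v = sum_i c_i k(x_i, .) is a
   bounded linear relation; boundedness makes it single-valued. *)
Let rkhs_graph F K : 0 <= K ->
  (forall s, `|\sum_(p <- s) p.1 * F p.2| <= K * nrm (comb k s)) ->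
  [/\ H F, nrm F <= K & exists s : nat -> seq (R * X),
     nrm (comb k (s n) \- F) @[n --> \oo] --> (0 : R)].
Proof.
move=> K0 FK.
pose G u a := exists s, u = comb k s /\ a = \sum_(p <- s) p.1 * F p.2.
have [||||g [Hg gK grep [v [Gv vg]]]] := @riesz_relation R X k H ip HR G K K0.
- exists [::]; rewrite big_nil; split=> //.
  by apply/funext => y; rewrite /comb big_nil.
- move=> c u v a b [s [-> ->]] [s' [-> ->]].
  exists (s ++ [seq (c * p.1, p.2) | p <- s']); rewrite comb_linear.
  split=> //; rewrite big_cat/= big_map mulr_sumr.
  by congr (_ + _); apply: eq_bigr => p _; rewrite mulrA.
- by move=> u a [s [-> _]]; exact: rkhs_comb.
- by move=> u a [s [-> ->]]; exact: FK.
have gF : g = F.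
  apply/funext => x; rewrite -(rkhs_reproducing HR x Hg); apply: grep.
  exists [:: (1, x)]; rewrite big_seq1 mul1r; split=> //.
  by apply/funext => y; rewrite /comb big_seq1 mul1r.
rewrite gF in Hg gK vg; split=> //.
have [s sv] : {s : nat -> seq (R * X) & forall n, v n = comb k (s n)}.
  by apply: (@choice _ _ (fun n s => v n = comb k s)) => n;
     have [a [s [vs _]]] := Gv n; exists s.
by exists s; under eq_fun do rewrite -sv.
Qed.

(** A function belongs to the space as soon as the functional that it induces on
    combinations of kernel sections is bounded: its Riesz representer has the
    values of the function, by the reproducing property. *)
Lemma rkhs_mem F K : 0 <= K ->
  (forall s, `|\sum_(p <- s) p.1 * F p.2| <= K * nrm (comb k s)) ->
  H F /\ nrm F <= K.
Proof. by move=> K0 /(rkhs_graph K0)[]. Qed.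

Lemma rkhs_approx f : H f -> exists s : nat -> seq (R * X),
  forall x, comb k (s n) x @[n --> \oo] --> f x.
Proof.
move=> Hf; have [||_ _ [s sf]] := @rkhs_graph f (nrm f).
- exact: ip_norm_ge0.
- move=> s; rewrite -ip_kernel_comb//.
  by apply: (ip_abs_le HR) => //; exact: rkhs_comb.
exists s => x; apply/cvgrPdist_lt => e e0.
have K1 : 0 < Num.sqrt (k x x) + 1 by rewrite ltr_wpDl ?sqrtr_ge0.
have eK : 0 < e / (Num.sqrt (k x x) + 1) by rewrite divr_gt0.
have [N _ hN] := (@cvgrPdist_lt _ R^o _ _ _ _ _).1 sf _ eK.
exists N => // n Nn; have := hN n Nn; rewrite sub0r normrN ger0_norm ?ip_norm_ge0//.
rewrite ltr_pdivlMr// distrC => h; apply: le_lt_trans h.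
have Hc := rkhs_comb Hk (s n).
apply: (le_trans (rkhs_eval_le HR x (rkhsB HR Hc Hf))).
by rewrite ler_wpM2l ?ip_norm_ge0// lerDl.
Qed.

End kernel_combinations.

(** * Quadratic forms *)

Section quadratic_forms.
Context {R : realType}.
Implicit Types d n : nat.

Lemma trmxZ m n c (P : 'M[R]_(m, n)) : (c *: P)^T = c *: P^T.
Proof. by apply/matrixP => i j; rewrite !mxE. Qed.

Lemma qform_congr d n (P : 'M[R]_(n, d)) (M : 'M[R]_n) (x : 'cV[R]_d) :
  qform (P^T *m M *m P) x = qform M (P *m x).
Proof. by rewrite /qform trmx_mul !mulmxA. Qed.

Lemma qformD d (M N : 'M[R]_d) x : qform (M + N) x = qform M x + qform N x.
Proof. by rewrite /qform mulmxDr mulmxDl mxE. Qed.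

Lemma qformB d (M N : 'M[R]_d) x : qform (M - N) x = qform M x - qform N x.
Proof. by rewrite /qform mulmxBr mulmxBl !mxE. Qed.

Lemma qformZ d c (M : 'M[R]_d) x : qform (c *: M) x = c * qform M x.
Proof. by rewrite /qform -scalemxAr -scalemxAl mxE. Qed.

Lemma qformN d (M : 'M[R]_d) x : qform M (- x) = qform M x.
Proof. by rewrite /qform mulmxN (raddfN trmx) !mulNmx opprK. Qed.

Lemma qform_0 d (M : 'M[R]_d) : qform M 0 = 0.
Proof. by rewrite /qform mulmx0 mxE. Qed.

Lemma qform_1 d (x : 'cV[R]_d) : qform 1%:M x = \sum_i x i 0 ^+ 2.
Proof.
by rewrite /qform mulmx1 mxE; apply: eq_bigr => i _; rewrite mxE expr2.
Qed.

Lemma posdef_psd d (M : 'M[R]_d) : posdef M -> possemidef M.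
Proof.
move=> [tM M0]; split=> // x; have [->|x0] := eqVneq x 0; first by rewrite qform_0.
exact/ltW/M0.
Qed.

Lemma qform_expand d (M : 'M[R]_d) c (x y : 'cV[R]_d) : M^T = M ->
  qform M (x + c *: y)
  = qform M x + 2 * c * (x^T *m M *m y) 0 0 + c ^+ 2 * qform M y.
Proof.
move=> tM; have sym : (y^T *m M *m x) 0 0 = (x^T *m M *m y) 0 0.
  transitivity ((y^T *m M *m x)^T 0 0); first by rewrite [RHS]mxE.
  by rewrite !trmx_mul trmxK tM mulmxA.
have e : (x + c *: y)^T = x^T + c *: y^T by rewrite linearD/= linearZ.
rewrite /qform e !mulmxDr !mulmxDl -!scalemxAr -!scalemxAl.
have mD (P Q : 'M[R]_1) : (P + Q) 0 0 = P 0 0 + Q 0 0 by rewrite mxE.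
have mZ b (P : 'M[R]_1) : (b *: P) 0 0 = b * P 0 0 by rewrite mxE.
by rewrite !(mD, mZ) sym; ring.
Qed.

(** If Mx were nonzero, moving from x in the direction - Mx would make the form
    negative. *)
Lemma possemidef_ker d (M : 'M[R]_d) (x : 'cV[R]_d) :
  possemidef M -> qform M x = 0 -> M *m x = 0.
Proof.
have alg (n q : R) : 0 < n -> 0 <= q ->
    2 * - (n / (q + 1)) * n + (- (n / (q + 1))) ^+ 2 * q < 0.
  move=> n0 q0.
  have -> : 2 * - (n / (q + 1)) * n + (- (n / (q + 1))) ^+ 2 * q
    = - ((n / (q + 1)) ^+ 2 * (q + 2)) by field; lra.
  rewrite oppr_lt0 mulr_gt0 ?exprn_gt0 ?divr_gt0//; lra.
move=> [tM M0] Mx0; set y := M *m x; apply/eqP/negPn/negP => y0.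
have Ey : (x^T *m M *m y) 0 0 = \sum_i y i 0 ^+ 2.
  by rewrite -[M in LHS]tM -trmx_mul -/y -qform_1 /qform mulmx1.
have n0 : 0 < \sum_i y i 0 ^+ 2.
  rewrite lt_neqAle sumr_ge0 ?andbT; last by move=> i _; rewrite sqr_ge0.
  apply: contra y0 => /eqP/esym/psumr_eq0P h; apply/eqP/matrixP => i j.
  have /eqP : y i 0 ^+ 2 = 0 by apply: h => // k _; exact: sqr_ge0.
  by rewrite sqrf_eq0 ord1 => /eqP ->; rewrite mxE.
set n := \sum_i _ in n0 Ey; have := M0 (x + (- (n / (qform M y + 1))) *: y).
by rewrite qform_expand// Mx0 Ey add0r leNgt alg.
Qed.

Lemma possemidef_unit d (M : 'M[R]_d) :
  possemidef M -> M \in unitmx -> posdef M.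
Proof.
move=> [tM M0] uM; split=> // x x0; rewrite lt_neqAle M0 andbT eq_sym.
apply: contra x0 => /eqP /(possemidef_ker (conj tM M0)) Mx0.
by rewrite -(mulKmx uM x) Mx0 mulmx0.
Qed.

Lemma posdef_unit d (M : 'M[R]_d) : posdef M -> M \in unitmx.
Proof.
move=> [tM M0]; rewrite -row_free_unit -kermx_eq0; apply/negPn/negP.
move=> /rowV0Pn[v /sub_kermxP vM v0].
have v0' : v^T != 0 by rewrite -(inj_eq trmx_inj) trmxK trmx0.
by have := M0 _ v0'; rewrite /qform trmxK vM mul0mx mxE ltxx.
Qed.

Lemma posdef_congr d (P M : 'M[R]_d) : P \in unitmx -> posdef M ->
  posdef (P *m M *m P^T).
Proof.
move=> uP [tM M0]; split; first by rewrite !trmx_mul trmxK tM mulmxA.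
move=> x x0; rewrite -{1}[P]trmxK qform_congr; apply: M0.
by apply: contra x0 => /eqP h; rewrite -(mulKmx (_ : P^T \in unitmx) x) ?h ?mulmx0//
  unitmx_tr.
Qed.

Lemma posdef_inv d (M : 'M[R]_d) : posdef M -> posdef (invmx M).
Proof.
move=> pM; have uM := posdef_unit pM; have [tM _] := pM.
have := posdef_congr (_ : invmx M \in unitmx) pM; rewrite unitmx_inv => /(_ uM).
by rewrite trmx_inv tM mulVmx// mul1mx.
Qed.

Lemma posdefD d (M N : 'M[R]_d) : posdef M -> possemidef N -> posdef (M + N).
Proof.
move=> [tM M0] [tN N0]; split; first by rewrite linearD/= tM tN.
by move=> x x0; rewrite qformD ltr_pwDl// M0.
Qed.

Lemma posdefZ d c (M : 'M[R]_d) : 0 < c -> posdef M -> posdef (c *: M).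
Proof.
move=> c0 [tM M0]; split; first by rewrite linearZ/= tM.
by move=> x x0; rewrite qformZ mulr_gt0// M0.
Qed.

(** Completing the square in the sum of two quadratic forms with distinct
    centres; the constant term is the parallel sum of the two forms. *)
Lemma qform_complete_square d (P Q : 'M[R]_d) (y w a : 'cV[R]_d) :
  posdef P -> posdef Q ->
  qform P (y - w) + qform Q (y - a)
  = qform (P + Q) (y - (a + invmx (P + Q) *m P *m (w - a)))
    + qform (invmx (invmx P + invmx Q)) (w - a).
Proof.
move=> pP pQ; have pN := posdefD pP (posdef_psd pQ).
have [uP uQ uN] := And3 (posdef_unit pP) (posdef_unit pQ) (posdef_unit pN).
have [tP tQ tN] := And3 pP.1 pQ.1 pN.1.
set N := P + Q; rewrite -/N in pN uN tN.
have -> : invmx (invmx P + invmx Q) = P - P *m invmx N *m P.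
  have h : (P - P *m invmx N *m P) *m (invmx P + invmx Q) = 1%:M.
    have h1 : P *m invmx N + P *m invmx N *m P *m invmx Q = P *m invmx Q.
      by rewrite -{1}(mulmxK uQ (P *m invmx N)) -mulmxDl -mulmxDr (addrC Q) mulmxKV.
    by rewrite mulmxBl !mulmxDr mulmxV// mulmxK// h1 addrK.
  by rewrite -[RHS]mulmx1 -(mulmxV (mulmx1_unit h).2) mulmxA h mul1mx.
set v := w - a; set z := y - a.
have -> : y - w = z + (-1) *: v by rewrite /z /v scaleN1r opprB addrA subrK.
have -> : y - (a + invmx N *m P *m v) = z + (-1) *: (invmx N *m P *m v).
  by rewrite scaleN1r opprD addrA.
rewrite !qform_expand// qformB qformD.
have -> : z^T *m N *m (invmx N *m P *m v) = z^T *m P *m v.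
  by rewrite -!mulmxA mulKVmx.
have -> : qform N (invmx N *m P *m v) = qform (P *m invmx N *m P) v.
  rewrite -qform_congr; congr qform.
  by rewrite trmx_mul trmx_inv tP tN -!mulmxA mulKVmx.
by ring.
Qed.

Lemma qform_col_mx d (a : R) (S : 'M[R]_d) (u : 'cV[R]_1) v :
  qform (block_mx (a%:M : 'M[R]_1) 0 0 S) (col_mx u v) = a * u 0 0 ^+ 2 + qform S v.
Proof.
rewrite /qform tr_col_mx mul_row_block !mulmx0 addr0 add0r mul_row_col mxE.
by congr (_ + _); rewrite mul_mx_scalar -scalemxAl !mxE big_ord1 mxE expr2.
Qed.

(** Schur complement: one step of the diagonalization of a positive definite form
    by successive completions of squares. *)
Lemma posdef_schur d (N : 'M[R]_(1 + d)) : posdef N ->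
  exists (a : R) (l : 'rV[R]_d) (S : 'M[R]_d), [/\ 0 < a, posdef S,
    \det N = a * \det S &
    forall (u : 'cV[R]_1) v, qform N (col_mx u v)
      = a * (u 0 0 + (l *m v) 0 0) ^+ 2 + qform S v].
Proof.
move=> [tN N0].
pose a := ulsubmx N 0 0; pose r := ursubmx N; pose D := drsubmx N.
have ul : ulsubmx N = a%:M by rewrite [LHS]mx11_scalar.
have dl : dlsubmx N = r^T by rewrite trmx_ursub tN.
have defN : N = block_mx a%:M r r^T D by rewrite -[LHS]submxK ul dl.
have a0 : 0 < a.
  have := N0 (col_mx 1%:M 0); rewrite /qform defN tr_col_mx mul_row_block mul_row_col.
  rewrite trmx0 trmx1 !mul0mx mulmx0 !addr0 !mul1mx mulmx1 mxE eqxx mulr1n; apply.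
  by apply/eqP => /matrixP/(_ (lshift _ 0) 0)/eqP; rewrite col_mxEu !mxE oner_eq0.
pose l := a^-1 *: r; pose S := D - a *: (l^T *m l).
pose U : 'M[R]_(1 + d) := block_mx 1%:M l 0 1%:M.
pose E : 'M[R]_(1 + d) := block_mx (a%:M : 'M[R]_1) 0 0 S.
have NU : N = U^T *m E *m U.
  have al : a *: l = r by rewrite scalerA mulfV ?gt_eqF// scale1r.
  rewrite defN /U /E tr_block_mx !trmx1 trmx0 !mulmx_block.
  rewrite !mulmx0 !mul0mx !mulmx1 !mul1mx !addr0 !add0r.
  have atl : l^T *m (a%:M : 'M[R]_1) = r^T by rewrite mul_mx_scalar -trmxZ al.
  by rewrite mul_scalar_mx atl al -al trmxZ -scalemxAl addrC subrK.
have qN x : qform N x = qform E (U *m x) by rewrite NU qform_congr.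
have Ucol u v : U *m col_mx u v = col_mx (u + l *m v) v.
  by rewrite mul_block_col !mul1mx mul0mx add0r.
have qNcol u v : qform N (col_mx u v)
    = a * (u 0 0 + (l *m v) 0 0) ^+ 2 + qform S v.
  by rewrite qN Ucol qform_col_mx mxE.
exists a, l, S; split=> //.
- split.
    have tD : D^T = D by rewrite trmx_drsub tN.
    by rewrite linearB/= linearZ/= trmx_mul trmxK tD.
  move=> v v0; have := N0 (col_mx (- (l *m v)) v); rewrite qNcol.
  rewrite [in X in X + _]mxE addNr expr0n mulr0 add0r; apply.
  apply: contra v0 => /eqP h; apply/eqP.
  by rewrite -[LHS](col_mxKd (- (l *m v))) h linear0.
- rewrite NU !det_mulmx det_tr det_ublock !det1 !mul1r mulr1.
  by rewrite det_ublock det_scalar1.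
Qed.

Lemma posdef_det_gt0 d (N : 'M[R]_d) : posdef N -> 0 < \det N.
Proof.
elim: d N => [|d IH] N pN; first by rewrite det_mx00.
have [a [l [S [a0 pS -> _]]]] := @posdef_schur d N pN.
by rewrite mulr_gt0// IH.
Qed.

End quadratic_forms.

(** * Gaussian integrals in several variables *)

Section gaussian_integral.
Context {R : realType}.
Local Open Scope ereal_scope.

Lemma measurable_qform d (M : 'M[R]_d) (b : 'cV[R]_d) :
  measurable_fun [set: 'cV[R]_d] (fun x => qform M (x - b)).
Proof.
have mc i : measurable_fun setT (fun x : 'cV[R]_d => (x - b)%R i 0%R).
  apply: (eq_measurable_fun (fun x : 'cV[R]_d => x i 0 - b i 0)%R).
    by move=> x _; rewrite !mxE.
  by apply: measurable_funB => //; exact: measurable_cV_coord.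
apply: (eq_measurable_fun (fun x : 'cV[R]_d =>
  \sum_j (\sum_i (x - b) i 0 * M i j) * (x - b) j 0)%R).
  move=> x _; rewrite /qform mxE; apply: eq_bigr => j _; congr (_ * _)%R.
  by rewrite mxE; apply: eq_bigr => i _; rewrite [in RHS]mxE.
apply: measurable_sum => j; apply: measurable_funM => //.
by apply: measurable_sum => i; exact: measurable_funM.
Qed.

Lemma powR_inv_oppr (x p : R) : (0 < x)%R -> (x^-1 `^ (- p) = x `^ p)%R.
Proof. by move=> x0; rewrite -(powR_inv1 (ltW x0)) -powRrM mulN1r opprK. Qed.

Lemma integral_gauss_line (a c : R) : (0 < a)%R ->
  \int[@lebesgue_measure R]_x (expR (- (2^-1 * (a * (x + c) ^+ 2))))%:E
  = ((2 * pi) `^ 2^-1 * a `^ (- 2^-1))%:E.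
Proof.
move=> a0; pose s := Num.sqrt a^-1.
have s0 : (0 < s)%R by rewrite sqrtr_gt0 invr_gt0.
have s2 : (s ^+ 2 = a^-1)%R by rewrite sqr_sqrtr// invr_ge0 ltW.
have sN0 : s != 0%R by rewrite gt_eqF.
have pk0 := normal_peak_gt0 sN0.
have := integral_normal_pdf (- c) s; rewrite /normal_pdf.
under eq_integral do rewrite (negbTE sN0) EFinM.
rewrite ge0_integralZl//=; last 3 first.
- by apply/measurable_EFinP; exact: measurable_normal_fun.
- by move=> x _; rewrite lee_fin normal_fun_ge0.
- by rewrite lee_fin ltW.
under eq_integral => x _.
  rewrite /normal_fun opprK s2 (_ : _ / _ = - (2^-1 * (a * (x + c) ^+ 2)))%R; last first.
    by rewrite -mulr_natr; field; rewrite gt_eqF.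
  over.
move=> h.
set J := integral _ _ _ in h *.
have -> : J = (normal_peak s)^-1%:E * ((normal_peak s)%:E * J).
  by rewrite muleA -EFinM mulVf ?gt_eqF// mul1e.
rewrite h mule1; congr EFin; rewrite /normal_peak invrK s2 -mulr_natr.
have ai0 : (0 <= a^-1)%R by rewrite invr_ge0 ltW.
have pi2 : (0 <= 2 * pi :> R)%R by rewrite mulr_ge0 ?pi_ge0.
have -> : (a^-1 * pi * 2 = 2 * pi * a^-1)%R by ring.
rewrite -powR12_sqrt ?mulr_ge0 ?pi_ge0// powRM//; congr (_ * _)%R.
by rewrite -(powR_inv1 (ltW a0)) -powRrM mulN1r.
Qed.

(** Gaussian integral of a positive definite form, by Fubini along the Schur
    complement: the first variable is integrated with the others fixed. *)
Lemma integral_gauss_qform d (N : 'M[R]_d) (b : 'cV[R]_d) : posdef N ->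
  \int[lebesgue_cV d]_x (expR (- (2^-1 * qform N (x - b))))%:E
  = ((2 * pi) `^ (d%:R / 2) * (\det N) `^ (- 2^-1))%:E.
Proof.
elim: d N b => [|d IH] N b pN.
  rewrite integral_dirac//; last first.
    apply/measurable_EFinP; apply: measurableT_comp => //.
    by apply: measurableT_comp => //; apply: measurable_funM => //; exact: measurable_qform.
  rewrite diracT mul1e (flatmx0 (_ - _)%R) qform_0 mulr0 oppr0.
  by rewrite expR0 det_mx00 powR1 mul0r powRr0 mulr1.
have [a [l [S [a0 pS dN qN]]]] := @posdef_schur R d N pN.
pose F (x : 'cV[R]_d.+1) := (expR (- (2^-1 * qform N (x - b))))%:E.
have mF : measurable_fun setT F.
  apply/measurable_EFinP; apply: measurableT_comp => //.
  by apply: measurableT_comp => //; apply: measurable_funM => //; exact: measurable_qform.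
transitivity (\int[pushforward (@lebesgue_measure R \x lebesgue_cV d) (@consV R d)]_x F x).
  by [].
rewrite (ge0_integral_pushforward (@measurable_consV R d))//; last first.
  by move=> x _; rewrite lee_fin expR_ge0.
rewrite preimage_setT fubini_tonelli2//; last 2 first.
- by apply: measurableT_comp => //; exact: measurable_consV.
- by move=> x; rewrite lee_fin expR_ge0.
pose b0 := usubmx (b : 'cV[R]_(1 + d)) 0%R 0%R.
pose b1 := dsubmx (b : 'cV[R]_(1 + d)).
have FE x0 x1 : F (consV (x0, x1)) =
    (expR (- (2^-1 * qform S (x1 - b1))))%:E *
    (expR (- (2^-1 * (a * (x0 + ((l *m (x1 - b1)) 0 0 - b0)) ^+ 2))))%:E.
  rewrite -EFinM -expRD /F -opprD -mulrDr; congr (expR (- (_ * _)))%:E.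
  have -> : (consV (x0, x1) - b = col_mx (const_mx (x0 - b0)) (x1 - b1) :> 'cV_(1 + d))%R.
    apply/matrixP => i j; rewrite !ord1.
    transitivity (consV (x0, x1) i 0 - b i 0)%R; first by rewrite mxE [X in (_ + X)%R]mxE.
    rewrite /consV.
    have [k ->|k ->] := @split_ordP 1 d i; rewrite ?(@col_mxEu R 1 d 1) ?(@col_mxEd R 1 d 1).
      by rewrite !ord1 !mxE /b0 mxE.
    by rewrite !mxE.
  rewrite qN mxE addrC; congr (_ + _ * _ ^+ 2)%R; ring.
rewrite /fubini_G; under eq_integral => x1 _.
  under eq_integral => x0 _ do rewrite /= FE.
  rewrite ge0_integralZl//=; last first.
    apply/measurable_EFinP; apply: measurableT_comp => //.
    apply: measurableT_comp => //; apply: measurable_funM => //.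
    by apply: measurable_funM => //; apply: measurable_funX; exact: measurable_funD.
  rewrite integral_gauss_line//; over.
rewrite /= ge0_integralZr//; last 2 first.
- apply/measurable_EFinP; apply: measurableT_comp => //.
  by apply: measurableT_comp => //; apply: measurable_funM => //; exact: measurable_qform.
- by rewrite lee_fin mulr_ge0 ?powR_ge0.
rewrite IH// -EFinM; congr EFin.
rewrite dN (powRM _ (ltW a0) (ltW (posdef_det_gt0 pS))).
have -> : (d.+1%:R / 2 = d%:R / 2 + 2^-1 :> R)%R by rewrite -natr1 mulrDl mul1r.
rewrite powRD; last by rewrite mulf_neq0 ?implybT// ?gt_eqF// ?pi_gt0.
ring.
Qed.

Lemma integral_gauss_pdf d (a : 'cV[R]_d) (S : 'M[R]_d) : posdef S ->
  \int[lebesgue_cV d]_x (gauss_pdf a S x)%:E = 1.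
Proof.
move=> pS; have dS := posdef_det_gt0 pS.
under eq_integral do rewrite /gauss_pdf EFinM.
rewrite ge0_integralZl//=; last 2 first.
- apply/measurable_EFinP; apply: measurableT_comp => //.
  by apply: measurableT_comp => //; apply: measurable_funM => //; exact: measurable_qform.
- by rewrite lee_fin mulr_ge0 ?powR_ge0.
rewrite integral_gauss_qform; last exact: posdef_inv.
rewrite -EFinM; congr EFin; rewrite det_inv powR_inv_oppr// !powRN; field.
by rewrite !gt_eqF ?powR_gt0// mulr_gt0 ?pi_gt0.
Qed.

End gaussian_integral.

Section density.
Local Open Scope ereal_scope.
Context {R : realType} {d : nat} (a : 'cV[R]_d) (S : 'M[R]_d).

Import HBNNSimple.

(** Integration against a measure given by a density, by monotone approximation with
    simple functions. *)
Lemma ge0_integral_gauss_measure (f : 'cV[R]_d -> \bar R) :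
  measurable_fun setT f -> (forall x, 0 <= f x) ->
  \int[gauss_measure a S]_x f x
  = \int[lebesgue_cV d]_x (f x * (gauss_pdf a S x)%:E).
Proof.
move=> mf f0.
have mg := measurable_gauss_pdf a S; have g0 := gauss_pdf_ge0 a S.
set g := gauss_pdf a S in mg g0 *.
pose h := nnsfun_approx measurableT mf.
have hf x : (EFin \o h n) x @[n --> \oo] --> f x by exact: cvg_nnsfun_approx.
have ndh x : {homo (fun n => (EFin \o h n) x) : m n / (m <= n)%N >-> m <= n}.
  by move=> m n mn; rewrite lee_fin; exact/lefP/nd_nnsfun_approx.
have mgE : measurable_fun setT (EFin \o g) by exact/measurable_EFinP.
have mhE n : measurable_fun setT (EFin \o h n) by exact/measurable_EFinP.
transitivity (limn (fun n => \int[gauss_measure a S]_x (EFin \o h n) x)).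
  rewrite -monotone_convergence//.
  - by apply: eq_integral => x _; apply/esym/cvg_lim => //; exact: hf.
  - by move=> n x _; rewrite lee_fin.
transitivity (limn (fun n => \int[lebesgue_cV d]_x ((EFin \o h n) x * (g x)%:E))); last first.
  rewrite -monotone_convergence//.
  - apply: eq_integral => x _; apply/cvg_lim => //.
    by apply: cvgeZr => //; exact: hf.
  - by move=> n; exact: emeasurable_funM.
  - by move=> n x _; rewrite mule_ge0 ?lee_fin.
  - by move=> x _ m n mn; rewrite lee_wpmul2r ?lee_fin//; exact: ndh.
congr (limn _); apply/funext => n.
have mi r : measurable_fun [set: 'cV[R]_d] (fun x => (r * \1_(h n @^-1` [set r]) x)%:E).
  by apply/measurable_EFinP; exact: measurable_funM.
transitivity (\int[gauss_measure a S]_x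
    (\sum_(r \in range (h n)) (r * \1_(h n @^-1` [set r]) x)%:E)).
  by apply: eq_integral => x _; rewrite /= fimfunE -fsumEFin.
rewrite ge0_integral_fsum//; last by move=> r x _; exact: nnfun_muleindic_ge0.
transitivity (\int[lebesgue_cV d]_x (\sum_(r \in range (h n))
    ((r * \1_(h n @^-1` [set r]) x)%:E * (g x)%:E))); last first.
  apply: eq_integral => x _.
  rewrite -ge0_mule_fsuml => [|r]; last exact: nnfun_muleindic_ge0.
  by rewrite fsumEFin // -(fimfunE _ x).
rewrite ge0_integral_fsum//; last 2 first.
- by move=> r; exact: emeasurable_funM.
- by move=> r x _; rewrite mule_ge0 ?lee_fin//; exact: nnfun_muleindic_ge0.
apply: eq_fsbigr => r _.
have [r0|r0] := leP 0%R r; last first.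
  rewrite preimage_nnfun0//; transitivity (0 : \bar R).
    by apply: integral0_eq => x _; rewrite indic0 mulr0.
  by apply/esym/integral0_eq => x _; rewrite indic0 mulr0 mul0e.
under eq_integral do rewrite EFinM.
rewrite ge0_integralZl//; last by apply/measurable_EFinP.
under [RHS]eq_integral do rewrite EFinM -muleA.
rewrite ge0_integralZl//; last 2 first.
- by apply: emeasurable_funM => //; exact/measurable_EFinP.
- by move=> x _; rewrite mule_ge0 ?lee_fin.
congr (_ * _); rewrite integral_indic// setIT.
transitivity (\int[lebesgue_cV d]_(x in h n @^-1` [set r]) (g x)%:E); first by [].
rewrite [LHS]integral_mkcond; apply: eq_integral => x _.
by rewrite patchE indicE; case: ifPn => _; rewrite ?mul1e ?mul0e.
Qed.

End density.

Section gaussian_convolution.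
Context {R : realType} {d : nat}.
Implicit Types (a b w : 'cV[R]_d) (S V : 'M[R]_d).
Local Open Scope ereal_scope.

Lemma gauss_measureT a S : posdef S -> gauss_measure a S setT = 1.
Proof. by move=> pS; rewrite /gauss_measure integral_gauss_pdf. Qed.

Lemma gauss_pdf_sym a S x : gauss_pdf a S x = gauss_pdf x S a.
Proof. by rewrite /gauss_pdf -qformN opprB. Qed.

(** Gaussian densities are stable under convolution: completing the square in the
    exponents leaves a Gaussian integral in the integration variable. *)
Lemma gauss_pdf_convolution a w S V : posdef S -> posdef V ->
  \int[gauss_measure a S]_y (gauss_pdf w V y)%:E = (gauss_pdf a (V + S)%R w)%:E.
Proof.
move=> pS pV; have pVS := posdefD pV (posdef_psd pS).
have [uS uV uVS] := And3 (posdef_unit pS) (posdef_unit pV) (posdef_unit pVS).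
have [dS dV dVS] := And3 (posdef_det_gt0 pS) (posdef_det_gt0 pV) (posdef_det_gt0 pVS).
have [piV piS] := conj (posdef_inv pV) (posdef_inv pS).
rewrite ge0_integral_gauss_measure; last 2 first.
- by apply/measurable_EFinP; exact: measurable_gauss_pdf.
- by move=> x; rewrite lee_fin gauss_pdf_ge0.
pose N := (invmx V + invmx S)%R; have pN : posdef N := posdefD piV (posdef_psd piS).
pose b := (a + invmx N *m invmx V *m (w - a))%R.
pose c := ((2 * pi) `^ (- (d%:R / 2)) * (\det S) `^ (- 2^-1) * gauss_pdf a (V + S) w
   * ((\det V) `^ (- 2^-1) / (\det (V + S)) `^ (- 2^-1)))%R.
under eq_integral => y _.
  rewrite -EFinM.
  have -> : (gauss_pdf w V y * gauss_pdf a S y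
     = c * expR (- (2^-1 * qform N (y - b))))%R.
    have VS0 : ((\det (V + S)) `^ (- 2^-1) != 0)%R by rewrite gt_eqF ?powR_gt0.
    have := qform_complete_square y w a piV piS; rewrite !invmxK -/N -/b => h.
    have e : (expR (- (2^-1 * qform (invmx V) (y - w)))
        * expR (- (2^-1 * qform (invmx S) (y - a)))
      = expR (- (2^-1 * qform N (y - b)))
        * expR (- (2^-1 * qform (invmx (V + S)) (w - a))))%R.
      by rewrite -!expRD -!opprD -!mulrDr h.
    rewrite /c /gauss_pdf mulrACA e; field.
    exact: VS0.
  rewrite EFinM; over.
rewrite ge0_integralZl//; last 2 first.
- apply/measurable_EFinP; apply: measurableT_comp => //.
  by apply: measurableT_comp => //; apply: measurable_funM => //; exact: measurable_qform.
- by rewrite lee_fin !mulr_ge0 ?powR_ge0 ?gauss_pdf_ge0// invr_ge0 powR_ge0.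
rewrite integral_gauss_qform// -EFinM; congr EFin.
(* the normalizing constants match because N = V^-1 (V + S) S^-1 *)
have dN : (\det N = \det (V + S) * (\det S)^-1 * (\det V)^-1)%R.
  have -> : N = (invmx V *m (V + S) *m invmx S)%R.
    by rewrite mulmxDr mulVmx// mulmxDl mul1mx mulmxK// addrC.
  by rewrite !det_mulmx !det_inv; ring.
rewrite /c dN !powRM ?mulr_ge0 ?invr_ge0 ?pi_ge0 ?(ltW dS) ?(ltW dV) ?(ltW dVS)//.
rewrite !powR_inv_oppr// !powRN; field.
by rewrite !gt_eqF ?powR_gt0 ?pi_gt0.
Qed.

End gaussian_convolution.

(** * The matrix exponential *)

Section pointwise_derivatives.
Context {R : realType}.
Implicit Types (x : R).

Lemma is_derive1_sum (I : Type) (r : seq I) (f : I -> R -> R) (df : I -> R) x :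
  (forall i, is_derive x 1 (f i) (df i)) ->
  is_derive x 1 (fun t => \sum_(i <- r) f i t) (\sum_(i <- r) df i).
Proof.
move=> fdf; elim: r => [|i r IH].
  by rewrite big_nil; under eq_fun do rewrite big_nil; exact: is_derive_cst.
by rewrite big_cons; under eq_fun do rewrite big_cons; exact: is_deriveD.
Qed.

Lemma is_derive1_mul (f g : R -> R) (df dg : R) x :
  is_derive x 1 f df -> is_derive x 1 g dg ->
  is_derive x 1 (fun t => f t * g t) (df * g x + f x * dg).
Proof.
move=> hf hg; apply: (is_derive_eq (is_deriveM hf hg)).
by rewrite addrC [g x *: df]mulrC.
Qed.

Lemma is_derive1_prod (I : eqType) (r : seq I) (f : I -> R -> R) (df : I -> R) x :
  uniq r -> (forall i, is_derive x 1 (f i) (df i)) ->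
  is_derive x 1 (fun t => \prod_(i <- r) f i t)
    (\sum_(k <- r) \prod_(i <- r) (if i == k then df i else f i x)).
Proof.
move=> + fdf; elim: r => [_|i r IH /= /andP[ir ur]].
  by rewrite big_nil; under eq_fun do rewrite big_nil; exact: is_derive_cst.
under eq_fun do rewrite big_cons.
apply: is_derive_eq; first exact: (is_derive1_mul (fdf i) (IH ur)).
rewrite big_cons big_cons eqxx; congr (_ * _ + _).
  apply: eq_big_seq => j jr; case: eqP => // ji.
  by rewrite -ji jr in ir.
rewrite mulr_sumr; apply: eq_big_seq => k kr; rewrite big_cons; case: eqP => // ik.
by rewrite ik kr in ir.
Qed.

Lemma is_derive1_continuous (f df : R -> R) :
  (forall x, is_derive x 1 f (df x)) -> continuous f.
Proof.
move=> fdf x; apply/differentiable_continuous/derivable1_diffP.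
exact: (@ex_derive _ _ _ _ _ _ _ (fdf x)).
Qed.

(** Jacobi's formula: the derivative of the Leibniz product of entries replaces
    one row at a time, and expanding along that row produces cofactors of the
    original matrix. *)
Lemma is_derive1_det n (F : R -> 'M[R]_n) (dF : 'M[R]_n) x :
  (forall i j, is_derive x 1 (fun t => F t i j) (dF i j)) ->
  is_derive x 1 (fun t => \det (F t)) (\tr (dF *m \adj (F x))).
Proof.
move=> FdF; rewrite /determinant.
apply: is_derive_eq.
  apply: is_derive1_sum => s; apply: is_derive1_mul.
  by apply: (is_derive1_prod (index_enum_uniq _)) => i; exact: FdF.
pose Fk k := \matrix_(i, j) (if i == k then dF i j else F x i j).
transitivity (\sum_k \det (Fk k)).
  rewrite [RHS]exchange_big/=; apply: eq_bigr => s _.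
  rewrite mul0r add0r mulr_sumr; apply: eq_bigr => k _; congr (_ * _).
  by apply: eq_bigr => i _; rewrite mxE.
rewrite /mxtrace; apply: eq_bigr => k _; rewrite (expand_det_row _ k) mxE.
apply: eq_bigr => j _; rewrite !mxE eqxx; congr (_ * _).
rewrite /cofactor; congr (_ * \det _); apply/matrixP => i l; rewrite !mxE.
by rewrite eq_sym (negbTE (neq_lift _ _)).
Qed.

End pointwise_derivatives.

Section matrix_exponential.
Context {R : realType} {d : nat}.
Implicit Types A : 'M[R]_d.

Lemma cvg_matrix_entries m n (u : nat -> 'M[R]_(m, n)) (L : 'M[R]_(m, n)) :
  (forall i j, u k i j @[k --> \oo] --> L i j) -> u @ \oo --> L.
Proof.
move=> uL; apply/cvgrPdist_le => /= e e0; near=> k.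
rewrite /Num.Def.normr/= mx_normrE (bigmax_le _ (ltW e0))//= => i _.
rewrite !mxE/=; move: i; near: k; apply: filter_forall => /= i.
exact: ((cvgrPdist_le _ _).1 (uL i.1 i.2)).
Unshelve. all: by end_near. Qed.

(** The sum of the absolute values of the entries is submultiplicative. *)
Lemma exprmx_entry_le A k i j : `|(A ^+ k) i j| <= (\sum_p `|A p.1 p.2|) ^+ k.
Proof.
set a := \sum_p _; have a0 : 0 <= a by exact: sumr_ge0.
elim: k i j => [|k IH] i j.
  by rewrite !expr0 mxE; case: eqP => _; rewrite ?normr1// normr0.
rewrite exprS mxE; apply: (le_trans (ler_norm_sum _ _ _)).
apply: (@le_trans _ _ ((\sum_l `|A i l|) * a ^+ k)).
  by rewrite mulr_suml; apply: ler_sum => l _; rewrite normrM ler_wpM2l.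
rewrite exprS ler_wpM2r ?exprn_ge0//.
rewrite /a -(pair_bigA _ (fun p q => `|A p q|))/= [leRHS](bigD1 i)//= lerDl.
by apply: sumr_ge0 => p _; exact: sumr_ge0.
Qed.

Lemma exprmxZ A t k : (t *: A) ^+ k = t ^+ k *: A ^+ k.
Proof.
elim: k => [|k IH]; first by rewrite !expr0 scale1r.
rewrite !exprS IH -[LHS]/((t *: A) *m (t ^+ k *: A ^+ k)).
by rewrite -scalemxAl -scalemxAr scalerA.
Qed.

Lemma is_cvg_pseries_fact (u : nat -> R) (a b x : R) : 0 <= a -> 0 <= b ->
  (forall k, `|u k| <= b * a ^+ k) ->
  cvgn (pseries (fun k => k`!%:R^-1 * u k) x).
Proof.
move=> a0 b0 ub; apply: normed_cvg.
apply: (@series_le_cvg R _ (fun k => b * exp_coeff (a * `|x|) k)) => //.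
- by move=> k; exact: normr_ge0.
- by move=> k; rewrite mulr_ge0 ?exp_coeff_ge0 ?mulr_ge0.
- move=> k; rewrite /= 2!normrM normrX normfV (ger0_norm (ler0n _ _)).
  rewrite /exp_coeff/= exprMn.
  have -> : b * (a ^+ k * `|x| ^+ k / k`!%:R) = k`!%:R^-1 * (b * a ^+ k) * `|x| ^+ k.
    by ring.
  by rewrite ler_wpM2r ?exprn_ge0// ler_wpM2l ?invr_ge0.
have /cvg_ex[l hl] := @is_cvg_series_exp_coeff R (a * `|x|).
apply/cvg_ex; exists (b * l); rewrite (_ : series _ = b \*o series (exp_coeff (a * `|x|))).
  exact: cvgMr.
by apply/funext => n; rewrite /series /= mulr_sumr.
Qed.

(** Limits of matrices are entrywise, so that each entry of t |-> e^{tA} is a power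
    series in t, with these coefficients, to which termwise differentiation
    applies. *)
Definition expmx_coef A (i j : 'I_d) (k : nat) : R := k`!%:R^-1 * (A ^+ k) i j.

Lemma is_cvg_expmx_coef A m i j x :
  cvgn (pseries (fun k => k`!%:R^-1 * (A ^+ (k + m)) i j) x).
Proof.
have a0 : 0 <= \sum_p `|A p.1 p.2| by exact: sumr_ge0.
apply: (@is_cvg_pseries_fact (fun k => (A ^+ (k + m)) i j)
  (\sum_p `|A p.1 p.2|) ((\sum_p `|A p.1 p.2|) ^+ m) x a0 (exprn_ge0 m a0)) => k.
by rewrite -exprD addnC; exact: exprmx_entry_le.
Qed.

Lemma expmx_entry A (t : R) :
  expmx (t *: A) = \matrix_(i, j) limn (pseries (expmx_coef A i j) t).
Proof.
apply: cvg_lim; first exact: norm_hausdorff.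
apply: cvg_matrix_entries => i j; rewrite mxE.
have := @is_cvg_expmx_coef A 0 i j t.
under [X in cvgn (pseries X _)]eq_fun do rewrite addn0.
move=> h; apply: cvg_trans h; apply: near_eq_cvg; near=> n.
rewrite /pseries /series/= summxE; apply: eq_bigr => k _.
by rewrite exprmxZ !mxE /expmx_coef mulrA mulrAC.
Unshelve. all: by end_near. Qed.

Lemma pseries_diffs_expmx_coef A m i j :
  pseries_diffs (fun k => k`!%:R^-1 * (A ^+ (k + m)) i j)
  = (fun k => k`!%:R^-1 * (A ^+ (k + m.+1)) i j).
Proof.
apply/funext => k; rewrite /pseries_diffs mulrA factS natrM addSnnS; congr (_ * _).
by rewrite invfM mulrA divff ?mul1r// pnatr_eq0.
Qed.

Lemma is_derive_expmx A (t : R) i j :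
  is_derive t 1 (fun s => expmx (s *: A) i j) ((expmx (t *: A) *m A) i j).
Proof.
pose c m := fun k => k`!%:R^-1 * (A ^+ (k + m)) i j.
have c0 : expmx_coef A i j = c 0%N by apply/funext => k; rewrite /c addn0.
under eq_fun do rewrite expmx_entry mxE c0.
apply: is_derive_eq.
  apply: (@pseries_snd_diffs _ _ (`|t| + 1)).
  - exact: is_cvg_expmx_coef.
  - by rewrite pseries_diffs_expmx_coef; exact: is_cvg_expmx_coef.
  - by rewrite !pseries_diffs_expmx_coef; exact: is_cvg_expmx_coef.
  - by rewrite [ltRHS]ger0_norm ?addr_ge0// ltrDl.
rewrite pseries_diffs_expmx_coef; apply: cvg_lim => //.
rewrite mxE (_ : pseries _ t =
    (fun n => \sum_l pseries (expmx_coef A i l) t n * A l j)).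
  apply: cvg_big => [|l _]; [exact: add_continuous|apply: cvgMl].
  rewrite expmx_entry mxE; have := @is_cvg_expmx_coef A 0 i l t.
  by under [X in cvgn (pseries X _)]eq_fun do rewrite addn0.
apply/funext => n; rewrite /pseries /series/=.
under [RHS]eq_bigr do rewrite mulr_suml.
rewrite exchange_big/=; apply: eq_bigr => k _.
rewrite addn1 exprSr mxE mulr_sumr mulr_suml; apply: eq_bigr => l _.
by rewrite /expmx_coef mulrA mulrAC.
Qed.

Lemma expmx0 A : expmx (0 *: A) = 1%:M.
Proof.
apply/matrixP => i j; rewrite expmx_entry mxE; apply: cvg_lim => //.
rewrite -cvg_shiftS /=.
rewrite (_ : (fun n => _) = fun=> (1%:M : 'M[R]_d) i j); first exact: cvg_cst.
apply/funext => n; rewrite /pseries /series/= big_nat_recl//= big1 => [|k _].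
  by rewrite addr0 expr0 mulr1 /expmx_coef fact0 invr1 mul1r expr0.
by rewrite exprS mul0r mulr0.
Qed.

Lemma expmx_tr A (t : R) : expmx (t *: A^T) = (expmx (t *: A))^T.
Proof.
apply/matrixP => i j; rewrite !expmx_entry !mxE; congr (limn (pseries _ _)).
apply/funext => k; rewrite /expmx_coef; congr (_ * _).
suff -> : A^T ^+ k = (A ^+ k)^T by rewrite mxE.
elim: k => [|k IH]; first by rewrite !expr0 trmx1.
by rewrite exprS exprSr IH -[LHS]/(A^T *m (A ^+ k)^T) -trmx_mul.
Qed.

(** Liouville's formula: by Jacobi's formula the determinant solves y' = tr(A) y. *)
Lemma det_expmx A (t : R) : \det (expmx (t *: A)) = expR (t * \tr A).
Proof.
have dD (x : R) : is_derive x 1 (fun s => \det (expmx (s *: A)))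
    (\tr A * \det (expmx (x *: A))).
  apply: is_derive_eq; first by apply: is_derive1_det => i j; exact: is_derive_expmx.
  by rewrite -mulmxA mxtrace_mulC -mulmxA mul_adj_mx mul_mx_scalar mxtraceZ mulrC.
have dE (x : R) : is_derive x 1 (fun s => expR (- \tr A * s)) (- \tr A * expR (- \tr A * x)).
  have -> : (fun s => expR (- \tr A * s)) = expR \o (- \tr A \*o id) by [].
  apply: is_derive_eq.
  by rewrite /GRing.scale/= mulr1 mulrC.
have h : \det (expmx (t *: A)) * expR (- \tr A * t) = 1.
  transitivity (\det (expmx (0 *: A)) * expR (- \tr A * 0)); last first.
    by rewrite mulr0 expR0 mulr1 expmx0 det1.
  apply: (@is_derive_0_is_cst R
    (fun s => \det (expmx (s *: A)) * expR (- \tr A * s))) => x.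
  by apply: (is_derive_eq (is_derive1_mul (dD x) (dE x))); ring.
have E0 : expR (- \tr A * t) != 0 by rewrite gt_eqF ?expR_gt0.
apply: (mulIf E0); rewrite h -expRD (_ : _ + _ = 0) ?expR0//; ring.
Qed.

End matrix_exponential.

(** * The covariance and the Lyapunov inequality *)

Section Rintegral_sums.
Context d (T : measurableType d) (R : realType) (mu : {measure set T -> \bar R}).
Variables (D : set T) (mD : measurable D).

Lemma integrable_EFin_sum (I : Type) (r : seq I) (f : I -> T -> R) :
  (forall i, mu.-integrable D (EFin \o f i)) ->
  mu.-integrable D (EFin \o (fun x => \sum_(i <- r) f i x)).
Proof.
move=> fi; rewrite (_ : EFin \o _ = fun x => (\sum_(i <- r) (EFin \o f i) x)%E).
  by apply: integrable_sum => // i _; exact: fi.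
by apply/funext => x /=; rewrite sumEFin.
Qed.

Lemma integrable_EFinZl (c : R) (f : T -> R) :
  mu.-integrable D (EFin \o f) -> mu.-integrable D (EFin \o (fun x => c * f x)).
Proof.
move=> fi; rewrite (_ : EFin \o _ = fun x => (c%:E * (EFin \o f) x)%E).
  exact: integrableZl.
by apply/funext => x.
Qed.

Lemma Rintegral_sum (I : Type) (r : seq I) (f : I -> T -> R) :
  (forall i, mu.-integrable D (EFin \o f i)) ->
  \int[mu]_(x in D) (\sum_(i <- r) f i x) = \sum_(i <- r) \int[mu]_(x in D) f i x.
Proof.
move=> fi; elim: r => [|i r IH].
  under eq_Rintegral do rewrite big_nil.
  by rewrite big_nil Rintegral_cst// mul0r.
under eq_Rintegral do rewrite big_cons.
by rewrite RintegralD ?IH ?big_cons//; exact: integrable_EFin_sum.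
Qed.

End Rintegral_sums.

Section matrix_derivatives.
Context {R : realType}.

Definition is_derive_mx m n (x : R) (F : R -> 'M[R]_(m, n)) (dF : 'M[R]_(m, n)) :=
  forall i j, is_derive x 1 (fun t => F t i j) (dF i j).

Lemma is_derive_mx_cst m n (x : R) (M : 'M[R]_(m, n)) : is_derive_mx x (fun=> M) 0.
Proof. by move=> i j; rewrite mxE; exact: is_derive_cst. Qed.

Lemma is_derive_mx_mul m n p (x : R) (F : R -> 'M[R]_(m, n)) (G : R -> 'M[R]_(n, p))
    dF dG : is_derive_mx x F dF -> is_derive_mx x G dG ->
  is_derive_mx x (fun t => F t *m G t) (dF *m G x + F x *m dG).
Proof.
move=> hF hG i j; under eq_fun do rewrite mxE.
rewrite !mxE -big_split/=; apply: is_derive1_sum => k.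
by apply: is_derive1_mul; [exact: hF|exact: hG].
Qed.

Lemma is_derive_mx_tr m n (x : R) (F : R -> 'M[R]_(m, n)) dF :
  is_derive_mx x F dF -> is_derive_mx x (fun t => (F t)^T) dF^T.
Proof. by move=> hF i j; under eq_fun do rewrite mxE; rewrite mxE; exact: hF. Qed.

End matrix_derivatives.

Section lyapunov.
Context {R : realType} {d : nat} (A : 'M[R]_d).
Implicit Types (K : 'M[R]_d) (x : 'cV[R]_d).
Local Notation mu := (@lebesgue_measure R).

Definition flow_congr K (s : R) : 'M[R]_d :=
  expmx (s *: A) *m K *m (expmx (s *: A))^T.

Lemma is_derive_flow_congr K (s : R) :
  is_derive_mx s (flow_congr K) (flow_congr (A *m K + K *m A^T) s).
Proof.
have dE : is_derive_mx s (fun t => expmx (t *: A)) (expmx (s *: A) *m A).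
  by move=> i j; exact: is_derive_expmx.
have dEK := is_derive_mx_mul dE (is_derive_mx_cst s K).
have := is_derive_mx_mul dEK (is_derive_mx_tr dE).
rewrite mulmx0 addr0 trmx_mul /flow_congr mulmxDr mulmxDl => h.
by rewrite !mulmxA in h *.
Qed.

Lemma qform_flow_congr K s x :
  qform (flow_congr K s) x = qform K ((expmx (s *: A))^T *m x).
Proof. by rewrite -qform_congr trmxK. Qed.

Lemma qform_sum (M : 'M[R]_d) x :
  qform M x = \sum_i \sum_j x i 0 * x j 0 * M i j.
Proof.
rewrite exchange_big/= /qform mxE; apply: eq_bigr => j _.
rewrite mxE mulr_suml; apply: eq_bigr => i _; rewrite !mxE; ring.
Qed.

Lemma is_derive_qform_flow_congr K x (s : R) :
  is_derive s 1 (fun t => qform (flow_congr K t) x)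
    (qform (flow_congr (A *m K + K *m A^T) s) x).
Proof.
under eq_fun do rewrite qform_sum; rewrite qform_sum.
apply: is_derive1_sum => i; apply: is_derive1_sum => j.
apply: (is_derive_eq (is_derive1_mul (is_derive_cst (x i 0 * x j 0 : R) s 1)
  (is_derive_flow_congr K s i j))).
by rewrite mul0r add0r.
Qed.

Lemma integrable_continuous_segment (f : R -> R) (t : R) : continuous f ->
  mu.-integrable `[0, t] (EFin \o f).
Proof.
move=> cf; apply: continuous_compact_integrable; first exact: segment_compact.
exact: continuous_subspaceT.
Qed.

Lemma continuous_flow_congr K i j : continuous (fun s => flow_congr K s i j).
Proof.
exact: (is_derive1_continuous (fun s => is_derive_flow_congr K s i j)).
Qed.

Lemma continuous_qform_flow_congr K x : continuous (fun s => qform (flow_congr K s) x).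
Proof. exact: (is_derive1_continuous (is_derive_qform_flow_congr K x)). Qed.

Variables (m : nat) (B : 'M[R]_(d, m)).

Lemma Sigma_tE (t : R) i j :
  Sigma_t A B t i j = \int[mu]_(s in `[0, t]) flow_congr (B *m B^T) s i j.
Proof.
rewrite mxE; apply: eq_Rintegral => s _.
by rewrite expmx_tr /flow_congr !mulmxA.
Qed.

Lemma qform_Sigma_t (t : R) x :
  qform (Sigma_t A B t) x = \int[mu]_(s in `[0, t]) qform (flow_congr (B *m B^T) s) x.
Proof.
have ii i j : mu.-integrable `[0, t]
    (EFin \o (fun s => flow_congr (B *m B^T) s i j)).
  exact/integrable_continuous_segment/continuous_flow_congr.
rewrite qform_sum; under [RHS]eq_Rintegral do rewrite qform_sum.
rewrite Rintegral_sum//; last first.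
  by move=> i; apply: integrable_EFin_sum => // j; exact: integrable_EFinZl.
apply: eq_bigr => i _; rewrite Rintegral_sum//; last first.
  by move=> j; exact: integrable_EFinZl.
by apply: eq_bigr => j _; rewrite RintegralZl// Sigma_tE.
Qed.

Lemma qform_gram (x : 'cV[R]_d) : 0 <= qform (B *m B^T) x.
Proof.
have -> : B *m B^T = B^T^T *m 1%:M *m B^T by rewrite trmxK mulmx1.
by rewrite qform_congr qform_1; apply: sumr_ge0 => i _; exact: sqr_ge0.
Qed.

Lemma Sigma_t_psd (t : R) : possemidef (Sigma_t A B t).
Proof.
split.
  apply/matrixP => i j; rewrite mxE !Sigma_tE; apply: eq_Rintegral => s _.
  have sym : (flow_congr (B *m B^T) s)^T = flow_congr (B *m B^T) s.
    by rewrite /flow_congr !trmx_mul !trmxK !mulmxA.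
  by rewrite -{1}sym mxE.
move=> x; rewrite qform_Sigma_t; apply: Rintegral_ge0 => s _.
by rewrite qform_flow_congr qform_gram.
Qed.

(** Integrated form of the Lyapunov inequality: along the flow, the derivative of
    e^{sA} K e^{sA^T} is the congruence of AK + KA^T, at most twice that of BB^T,
    whose integral is the covariance. *)
Lemma lyapunov_integrated K (t : R) : K^T = K -> 0 < t ->
  loewner_le (2^-1 *: (A *m K + K *m A^T)) (B *m B^T) ->
  loewner_le (flow_congr K t) (K + 2 *: Sigma_t A B t).
Proof.
move=> tK t0 [_ AKB]; have [tS _] := Sigma_t_psd t.
split.
  by rewrite linearB linearD/= trmxZ tS tK /flow_congr !trmx_mul trmxK tK mulmxA.
move=> x; rewrite qformB qformD qformZ.
pose AK := A *m K + K *m A^T.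
have ftc : \int[mu]_(s in `[0, t]) qform (flow_congr AK s) x
    = qform (flow_congr K t) x - qform K x.
  have dq s := is_derive_qform_flow_congr K x s.
  rewrite /Rintegral (@continuous_FTC2 _ _ (fun s => qform (flow_congr K s) x))//.
  - rewrite -EFinB/= {2}/flow_congr expmx0 trmx1 mulmx1 mul1mx//.
  - exact/continuous_subspaceT/continuous_qform_flow_congr.
  - split=> [s _| |].
    + exact: (@ex_derive _ _ _ _ _ _ _ (dq s)).
    + exact/cvg_at_right_filter/continuous_qform_flow_congr.
    + exact/cvg_at_left_filter/continuous_qform_flow_congr.
  - by move=> s _; rewrite derive1E (@derive_val _ _ _ _ _ _ _ (dq s)).
have -> : qform K x + 2 * qform (Sigma_t A B t) x - qform (flow_congr K t) x
    = 2 * qform (Sigma_t A B t) x - \int[mu]_(s in `[0, t]) qform (flow_congr AK s) x.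
  by rewrite ftc; ring.
have ci K' := integrable_continuous_segment t (@continuous_qform_flow_congr K' x).
rewrite subr_ge0 qform_Sigma_t -RintegralZl//.
apply: le_Rintegral => //; [exact: integrable_EFinZl|move=> s _].
rewrite !qform_flow_congr.
have := AKB ((expmx (s *: A))^T *m x); rewrite qformB qformZ; lra.
Qed.

End lyapunov.

(** * Gaussian kernels and Gaussian expectations *)

Section gaussian_expectation.
Context {R : realType} {d : nat}.
Implicit Types (a w : 'cV[R]_d) (S : 'M[R]_d) (f : 'cV[R]_d -> R).
Local Notation gm := gauss_measure.

Lemma integrable_gauss_bounded a S f (K : R) : posdef S ->
  measurable_fun setT f -> (forall x, `|f x| <= K) ->
  (gm a S).-integrable setT (EFin \o f).
Proof.
move=> pS mf fK; apply: measurable_bounded_integrable => //.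
  by rewrite [X in (X < _)%E](gauss_measureT a pS) ltry.
by exists K; split; [exact: num_real|move=> M KM x _; exact/(le_trans (fK x))/ltW].
Qed.

Lemma Rintegral_gauss_cst a S (r : R) : posdef S -> \int[gm a S]_x r = r.
Proof.
by move=> pS; rewrite Rintegral_cst// [X in fine X](gauss_measureT a pS) mulr1.
Qed.

Lemma Rintegral_gauss_le a S f (K r : R) : posdef S ->
  measurable_fun setT f -> (forall x, `|f x| <= K) -> (forall x, f x <= r) ->
  \int[gm a S]_x f x <= r.
Proof.
move=> pS mf fK fr; rewrite -[leRHS](Rintegral_gauss_cst a r pS).
apply: le_Rintegral => //; first exact: integrable_gauss_bounded fK.
exact: (@integrable_gauss_bounded _ _ _ `|r|).
Qed.

Lemma Rintegral_gauss_pdf a w S V : posdef S -> posdef V ->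
  \int[gm a S]_y gauss_pdf w V y = gauss_pdf a (V + S) w.
Proof. by move=> pS pV; rewrite /Rintegral gauss_pdf_convolution. Qed.

Lemma gauss_pdf_center a x S : gauss_pdf a S x = gauss_pdf 0 S (x - a).
Proof. by rewrite /gauss_pdf subr0. Qed.

(** Change of variables in a Gaussian density; the sign of the determinant matters
    because its absolute value is what appears. *)
Lemma gauss_pdf_linear (M V : 'M[R]_d) a x : 0 < \det M -> posdef V ->
  gauss_pdf (M *m a) V (M *m x)
  = (\det M)^-1 * gauss_pdf a (invmx M *m V *m (invmx M)^T) x.
Proof.
move=> dM pV; have uM : M \in unitmx by rewrite unitmxE unitfE gt_eqF.
have dV := posdef_det_gt0 pV.
set Q := invmx M *m V *m (invmx M)^T.
have VQ : V = M *m Q *m M^T.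
  by rewrite /Q trmx_inv !mulmxA mulmxV// mul1mx mulmxKV// unitmx_tr.
have pQ : posdef Q by apply: posdef_congr; rewrite ?unitmx_inv.
have dQ := posdef_det_gt0 pQ; clearbody Q.
rewrite /gauss_pdf -mulmxBr.
have -> : qform (invmx V) (M *m (x - a)) = qform (invmx Q) (x - a).
  rewrite -qform_congr; congr qform; rewrite VQ.
  have uQ := posdef_unit pQ; have uMt : M^T \in unitmx by rewrite unitmx_tr.
  have h : (M *m Q *m M^T) *m (invmx M^T *m invmx Q *m invmx M) = 1%:M.
    by rewrite !mulmxA mulmxK// mulmxK// mulmxV.
  have uMQ : M *m Q *m M^T \in unitmx by rewrite !unitmx_mul uM uQ uMt.
  have -> : invmx (M *m Q *m M^T) = invmx M^T *m invmx Q *m invmx M.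
    by rewrite -[RHS]mul1mx -(mulVmx uMQ) -[RHS]mulmxA h mulmx1.
  by rewrite !mulmxA mulmxV// mul1mx mulmxKV.
have -> : \det V = \det M ^+ 2 * \det Q.
  by rewrite VQ !det_mulmx det_tr; ring.
rewrite (powRM _ (exprn_ge0 2 (ltW dM)) (ltW dQ)) -(powR_mulrn 2 (ltW dM)) -powRrM.
rewrite mulrN divff ?pnatr_eq0// (powR_inv1 (ltW dM)); ring.
Qed.

End gaussian_expectation.

Section gaussian_rkhs.
Context {R : realType} {d : nat} (C : 'M[R]_d).
Variables (H : set ('cV[R]_d -> R)) (ip : ('cV[R]_d -> R) -> ('cV[R]_d -> R) -> R).
Hypotheses (pC : posdef C) (HR : is_rkhs (gauss_kernel C) H ip).
Implicit Types (f : 'cV[R]_d -> R) (s : seq (R * 'cV[R]_d)).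
Local Notation k := (gauss_kernel C).
Local Notation nrm := (ip_norm ip).
Local Notation V := (2^-1 *: C ^+ 2).
Local Notation gm := gauss_measure.

Lemma posdef_sqr : posdef (C ^+ 2).
Proof.
have uC := posdef_unit pC; have [tC _] := pC.
have p1 : posdef (1%:M : 'M[R]_d).
  apply: possemidef_unit; last exact: unitmx1.
  by split=> [|x]; rewrite ?trmx1// qform_1 sumr_ge0// => i _; exact: sqr_ge0.
have := posdef_congr uC p1; rewrite mulmx1 tC expr2.
by [].
Qed.

Lemma posdef_half_sqr : posdef V.
Proof. by apply: posdefZ => //; exact: posdef_sqr. Qed.

(* the ratio of the kernel to the Gaussian density of covariance V *)
Let c0 := ((2 * pi) `^ (- (d%:R / 2)) * (\det V) `^ (- 2^-1))^-1.

Let gauss_kernelE x y : k x y = c0 * gauss_pdf y V x.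
Proof.
have dV := posdef_det_gt0 posdef_half_sqr.
rewrite /gauss_pdf mulrA /c0 mulVf ?mul1r; last first.
  by rewrite mulf_neq0// gt_eqF// powR_gt0// mulr_gt0// pi_gt0.
congr (expR (- _)); rewrite invmxZ ?(posdef_unit posdef_half_sqr)//.
by rewrite qformZ invrK mulKf.
Qed.

Lemma gauss_kernel_sym x y : k x y = k y x.
Proof. by rewrite !gauss_kernelE gauss_pdf_sym. Qed.

Lemma gauss_kernel_diag x : k x x = 1.
Proof. by rewrite /gauss_kernel subrr qform_0 oppr0 expR0. Qed.

Let c0_neq0 : c0 != 0.
Proof.
have := gauss_kernel_diag 0; rewrite gauss_kernelE => /eqP.
by apply: contraTneq => ->; rewrite mul0r eq_sym oner_eq0.
Qed.

Lemma measurable_gauss_kernel x : measurable_fun setT (k x).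
Proof.
apply: (eq_measurable_fun (fun y => c0 * gauss_pdf x V y)).
  by move=> y _; rewrite gauss_kernel_sym gauss_kernelE.
by apply: measurable_funM => //; exact: measurable_gauss_pdf.
Qed.

(** A function of the space is a pointwise limit of combinations of kernel sections,
    which are measurable. *)
Lemma measurable_gauss_rkhs f : H f -> measurable_fun setT f.
Proof.
move=> Hf; have [s sf] := rkhs_approx HR Hf.
apply: (@measurable_fun_cvg _ _ _ _ (fun n => comb k (s n))) => [n|x _]; last exact: sf.
apply: measurable_sum => p; apply: measurable_funM => //.
exact: measurable_gauss_kernel.
Qed.

Lemma gauss_rkhs_le f x : H f -> `|f x| <= nrm f.
Proof.
move=> Hf; have := rkhs_eval_le HR x Hf.
by rewrite gauss_kernel_diag sqrtr1 mulr1.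
Qed.

Lemma integrable_gauss_rkhs a S f : posdef S -> H f ->
  (gm a S).-integrable setT (EFin \o f).
Proof.
move=> pS Hf; apply: (@integrable_gauss_bounded _ _ _ _ _ (nrm f)) => //.
  exact: measurable_gauss_rkhs.
by move=> x; exact: gauss_rkhs_le.
Qed.

Lemma Rintegral_gauss_kernel a S w : posdef S ->
  \int[gm a S]_y k w y = c0 * gauss_pdf a (V + S) w.
Proof.
move=> pS; have pV := posdef_half_sqr.
under eq_Rintegral => y _ do rewrite gauss_kernel_sym gauss_kernelE.
rewrite RintegralZl//; first by rewrite Rintegral_gauss_pdf.
have h := integrable_gauss_rkhs a pS (rkhs_kernel HR w).
have -> : EFin \o gauss_pdf w V = EFin \o (fun y => c0^-1 * k w y).
  by apply/funext => y /=; rewrite gauss_kernel_sym gauss_kernelE mulKf.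
exact: integrable_EFinZl.
Qed.

(** Spreading the kernel by an extra Gaussian decreases its quadratic forms: such a
    form is the average over u of <psi, psi(. - u)>, and translations preserve the
    norm since the kernel is translation invariant. *)
Lemma gauss_kernel_smoothing_le U s : posdef U ->
  \sum_(p <- s) \sum_(q <- s) p.1 * q.1 * (c0 * gauss_pdf q.2 (V + U) p.2)
  <= nrm (comb k s) ^+ 2.
Proof.
move=> pU; have Hk := rkhs_kernel HR.
pose psi (u x : 'cV[R]_d) := k (x + u).
have Hpsi u x : H (psi u x) by exact: Hk.
pose F u := \sum_(p <- s) \sum_(q <- s) p.1 * q.1 * k (p.2 - q.2) u.
have FE u : F u = ip (comb k s) (comb (psi u) s).
  rewrite (ip_comb HR (Hpsi u)); last exact: (rkhs_comb HR Hk).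
  rewrite /F exchange_big; apply: eq_bigr => q _.
  rewrite (rkhs_reproducing HR); last exact: (rkhs_comb HR Hk).
  rewrite /comb mulr_sumr; apply: eq_bigr => p _.
  have -> : k p.2 (q.2 + u) = k (p.2 - q.2) u by rewrite /gauss_kernel opprD addrA.
  ring.
have norm_psi u : nrm (comb (psi u) s) = nrm (comb k s).
  apply/eqP; rewrite -(@eqrXn2 _ 2) ?ip_norm_ge0//; apply/eqP.
  rewrite (sqr_norm_comb HR (Hpsi u)) (sqr_norm_comb HR Hk).
  apply: eq_bigr => p _; apply: eq_bigr => q _; congr (_ * _).
  by rewrite /psi !(rkhs_reproducing HR)// /gauss_kernel opprD addrACA subrr addr0.
have FK u : `|F u| <= nrm (comb k s) ^+ 2.
  rewrite FE expr2 -{2}(norm_psi u).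
  by apply: (ip_abs_le HR); [exact: (rkhs_comb HR Hk)|exact: (rkhs_comb HR (Hpsi u))].
have ki p q : (gm 0 U).-integrable setT
    (EFin \o (fun u => p.1 * q.1 * k (p.2 - q.2) u)) :> Prop.
  by apply: integrable_EFinZl => //; exact: integrable_gauss_rkhs.
have -> : \sum_(p <- s) \sum_(q <- s) p.1 * q.1 * (c0 * gauss_pdf q.2 (V + U) p.2)
    = \int[gm 0 U]_u F u.
  rewrite Rintegral_sum//; last by move=> p; exact: integrable_EFin_sum.
  apply: eq_bigr => p _; rewrite Rintegral_sum//; apply: eq_bigr => q _.
  rewrite RintegralZl//; last exact: integrable_gauss_rkhs.
  by rewrite Rintegral_gauss_kernel// -gauss_pdf_center.
apply: (@Rintegral_gauss_le _ _ _ _ _ (nrm (comb k s) ^+ 2)) => //.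
- rewrite /F; apply: measurable_sum => p; apply: measurable_sum => q.
  by apply: measurable_funM => //; exact: measurable_gauss_kernel.
- by move=> u; apply: le_trans (FK u); exact: ler_norm.
Qed.

(** The operator f |-> E f(Mx + Z), with Z centred of covariance S, has for adjoint
    an operator that sends the kernel section at x to the representer phi x; the
    Gram matrix of the phi x is again Gaussian, with covariance V + 2S seen
    through M, so that it is compared with the kernel by the preceding lemma. *)
Lemma gauss_rkhs_operator (M S : 'M[R]_d) f :
  0 < \det M -> posdef S -> posdef (V + S + S - M *m V *m M^T) -> H f ->
  let Tf := fun x => \int[gm (M *m x) S]_y f y in
  H Tf /\ nrm Tf <= Num.sqrt (\det M)^-1 * nrm f.
Proof.
move=> dM pS pD Hf Tf; have Hk := rkhs_kernel HR.
have pV := posdef_half_sqr; have pVS := posdefD pV (posdef_psd pS).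
have pVSS := posdefD pVS (posdef_psd pS).
have uM : M \in unitmx by rewrite unitmxE unitfE gt_eqF.
pose T u x := \int[gm (M *m x) S]_y u y.
have [phi Hphi] : {phi : 'cV[R]_d -> 'cV[R]_d -> R &
    forall x, H (phi x) /\ forall u, H u -> ip (phi x) u = T u x}.
  apply: (@choice _ _ (fun x g => H g /\ forall u, H u -> ip g u = T u x)) => x.
  have [||||g [Hg _ gT _]] :=
      @riesz_relation _ _ _ _ _ HR (fun u a => H u /\ a = T u x) 1 ler01.
  - by split; [exact: (rkhs0 HR)|rewrite /T Rintegral_gauss_cst].
  - move=> c u v a b [Hu ->] [Hv ->]; split; first exact: (rkhs_scaleD HR).
    rewrite /T RintegralD ?RintegralZl//.
    + exact: integrable_gauss_rkhs.
    + exact: integrable_gauss_rkhs.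
    + by apply: integrable_EFinZl => //; exact: integrable_gauss_rkhs.
  - by move=> u a [].
  - move=> u _ [Hu ->]; rewrite mul1r.
    apply: (le_trans (le_normr_Rintegral _ _)) => //.
      exact: integrable_gauss_rkhs.
    apply: (@Rintegral_gauss_le _ _ _ _ _ (nrm u)) => //.
    + by apply: measurableT_comp => //; exact: measurable_gauss_rkhs.
    + by move=> y; rewrite normr_id; exact: gauss_rkhs_le.
    + by move=> y; exact: gauss_rkhs_le.
  by exists g; split=> // u Hu; exact: gT.
have {}Hphi' x : H (phi x) := (Hphi x).1.
have phiT x u : H u -> ip (phi x) u = T u x := (Hphi x).2 u.
have phiE x z : phi x z = c0 * gauss_pdf (M *m x) (V + S) z.
  by rewrite -(rkhs_reproducing HR z (Hphi' x)) phiT// /T Rintegral_gauss_kernel.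
pose U := invmx M *m (V + S + S - M *m V *m M^T) *m (invmx M)^T.
have pU : posdef U by apply: posdef_congr; rewrite ?unitmx_inv.
have VU : V + U = invmx M *m (V + S + S) *m (invmx M)^T.
  rewrite /U mulmxBr mulmxBl !mulmxA mulVmx// mul1mx trmx_inv mulmxK ?unitmx_tr//.
  by rewrite addrC subrK.
(* phi y is a multiple of a Gaussian density, to be averaged once more *)
have gram x y : ip (phi x) (phi y) = (\det M)^-1 * (c0 * gauss_pdf y (V + U) x).
  rewrite phiT// /T; under eq_Rintegral => z _ do rewrite phiE.
  rewrite RintegralZl//; last first.
    have -> : EFin \o gauss_pdf (M *m y) (V + S) = EFin \o (fun z => c0^-1 * phi y z).
      by apply/funext => z /=; rewrite phiE mulKf.
    by apply: integrable_EFinZl => //; exact: integrable_gauss_rkhs.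
  rewrite Rintegral_gauss_pdf// gauss_pdf_sym gauss_pdf_linear// -VU.
  by rewrite mulrCA gauss_pdf_sym.
have normphi s : nrm (comb phi s) <= Num.sqrt (\det M)^-1 * nrm (comb k s).
  rewrite -(@ler_pXn2r _ 2)// ?nnegrE ?mulr_ge0 ?ip_norm_ge0 ?sqrtr_ge0//.
  have sq : Num.sqrt (\det M)^-1 ^+ 2 = (\det M)^-1.
    by rewrite sqr_sqrtr// invr_ge0 ltW.
  rewrite exprMn sq (sqr_norm_comb HR Hphi').
  under eq_bigr do under eq_bigr do rewrite gram mulrCA.
  under eq_bigr do rewrite -mulr_sumr.
  by rewrite -mulr_sumr ler_wpM2l ?invr_ge0 ?(ltW dM)//; exact: gauss_kernel_smoothing_le.
apply: (rkhs_mem HR) => [|s]; first by rewrite mulr_ge0 ?sqrtr_ge0 ?ip_norm_ge0.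
have -> : \sum_(p <- s) p.1 * Tf p.2 = ip f (comb phi s).
  rewrite (ip_comb HR Hphi')//; apply: eq_bigr => p _.
  by rewrite (rkhs_ipC HR)// phiT.
apply: (le_trans (ip_abs_le HR Hf (rkhs_comb HR Hphi' s))).
rewrite -mulrA mulrCA ler_wpM2l ?ip_norm_ge0//.
Qed.

End gaussian_rkhs.

(** * Koopman operators *)

Section degenerate_cases.
Context {R : realType} {d m : nat} (A : 'M[R]_d) (B : 'M[R]_(d, m)).
Implicit Types (f h : 'cV[R]_d -> R) (S : 'M[R]_d).

Lemma koopman0 f : measurable_fun setT f -> koopman A B 0 f = f.
Proof.
move=> mf; apply/funext => x; rewrite /koopman /transition eqxx /Rintegral.
rewrite integral_dirac//; last exact/measurable_EFinP.
by rewrite diracT mul1e.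
Qed.

Lemma koopman_gauss (t : R) f x : t != 0 ->
  koopman A B t f x = \int[gauss_measure (expmx (t *: A) *m x) (Sigma_t A B t)]_y f y.
Proof. by move=> t0; rewrite /koopman /transition (negbTE t0). Qed.

(** The normalizing factor contains 0 `^ (- 1/2) = 0. *)
Lemma gauss_measure_singular (a : 'cV[R]_d) S (D : set 'cV[R]_d) :
  \det S = 0 -> gauss_measure a S D = 0%E.
Proof.
by move=> dS; apply: integral0_eq => x _; rewrite /gauss_pdf dS powR0 ?mulr0 ?mul0r.
Qed.

Lemma koopman_singular (t : R) f : t != 0 -> \det (Sigma_t A B t) = 0 ->
  koopman A B t f = fun=> 0.
Proof.
move=> t0 dS; apply/funext => x; rewrite koopman_gauss// /Rintegral.
rewrite (eq_measure_integral mzero) ?integral_measure_zero// => D mD _.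
by rewrite [LHS]gauss_measure_singular.
Qed.

Lemma lebesgue_null_gauss_null (a : 'cV[R]_d) S (N : set 'cV[R]_d) :
  measurable N -> lebesgue_cV d N = 0%E -> gauss_measure a S N = 0%E.
Proof.
move=> mN N0; apply: null_set_integral => //; apply/measurable_EFinP.
by apply: measurable_funTS; exact: measurable_gauss_pdf.
Qed.

Lemma gauss_null_lebesgue_null (a : 'cV[R]_d) S (N : set 'cV[R]_d) :
  measurable N -> \det S != 0 -> gauss_measure a S N = 0%E ->
  lebesgue_cV d N = 0%E.
Proof.
move=> mN dS N0.
have pdf_gt0 x : 0 < gauss_pdf a S x.
  rewrite lt_neqAle gauss_pdf_ge0 andbT eq_sym /gauss_pdf !mulf_neq0//.
  - by rewrite powR_eq0 mulf_eq0 (gt_eqF (pi_gt0 R)) pnatr_eq0.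
  - by rewrite powR_eq0 (negbTE dS).
  - by rewrite gt_eqF// expR_gt0.
have mg : measurable_fun N (EFin \o gauss_pdf a S).
  by apply/measurable_EFinP/measurable_funTS; exact: measurable_gauss_pdf.
have : (\int[lebesgue_cV d]_(x in N) `|(gauss_pdf a S x)%:E| = 0)%E.
  by under eq_integral do rewrite gee0_abs ?lee_fin ?gauss_pdf_ge0//.
move=> /(ae_eq_integral_abs _ mN mg)[Z [mZ Z0 NZ]].
apply: (subset_measure0 mN mZ _ Z0) => x Nx; apply: NZ => /= /(_ Nx) [] /eqP.
by rewrite gt_eqF.
Qed.

(** When S is invertible the density of N(a, S) has no zero, so that its null sets are
    those of Lebesgue measure, which the transition laws do not charge. *)
Lemma koopman_ae_eq (t : R) (a : 'cV[R]_d) S f h : t != 0 -> \det S != 0 ->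
  measurable_fun setT f -> measurable_fun setT h ->
  f = h %[ae gauss_measure a S] -> koopman A B t f = koopman A B t h.
Proof.
move=> t0 dS mf mh [N [mN N0 fhN]]; apply/funext => x; rewrite !koopman_gauss//.
rewrite /Rintegral; congr fine; apply: ae_eq_integral => //.
- exact/measurable_EFinP.
- exact/measurable_EFinP.
exists N; split; first exact: mN.
  exact: (lebesgue_null_gauss_null _ _ mN (gauss_null_lebesgue_null mN dS N0)).
by move=> y /= hy; apply: fhN => /= fhy; apply: hy => _; rewrite fhy.
Qed.

End degenerate_cases.

Section koopman_rkhs.
Context {R : realType} {d m : nat} (A : 'M[R]_d) (B : 'M[R]_(d, m)) (C : 'M[R]_d).
Variables (H : set ('cV[R]_d -> R)) (ip : ('cV[R]_d -> R) -> ('cV[R]_d -> R) -> R).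

Lemma koopman_rkhs (t : R) (f : 'cV[R]_d -> R) : posdef C ->
  loewner_le (2^-1 *: (A *m C ^+ 2 + C ^+ 2 *m A^T)) (B *m B^T) ->
  is_rkhs (gauss_kernel C) H ip -> 0 <= t -> H f ->
  H (koopman A B t f) /\
  ip_norm ip (koopman A B t f) <= expR (t * \tr (- A) / 2) * ip_norm ip f.
Proof.
move=> pC ACB HR + Hf; rewrite le_eqVlt => /predU1P[<-|t0].
  rewrite koopman0; last exact: (measurable_gauss_rkhs pC HR Hf).
  by rewrite !mul0r expR0 mul1r.
have tN0 : t != 0 by rewrite gt_eqF.
(* a singular covariance makes the transition measures, hence K^t f, vanish *)
have [dS0|dS] := eqVneq (\det (Sigma_t A B t)) 0.
  rewrite koopman_singular//; split; first exact: (rkhs0 HR).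
  rewrite (_ : ip_norm ip (fun=> 0) = 0) ?mulr_ge0 ?expR_ge0 ?ip_norm_ge0//.
  have H0 := rkhs0 HR; apply/eqP; rewrite /ip_norm sqrtr_eq0.
  rewrite -[X in ip X _](_ : 0 \*o (fun=> 0) = _); last first.
    by apply/funext => x /=; rewrite mul0r.
  by rewrite (rkhs_ipZl HR)// mul0r.
set M := expmx (t *: A); set S := Sigma_t A B t in dS.
have Spsd : possemidef S := Sigma_t_psd A B t.
have pS : posdef S by apply: possemidef_unit => //; rewrite unitmxE unitfE.
have dM : \det M = expR (t * \tr A) by exact: det_expmx.
have dM0 : 0 < \det M by rewrite dM expR_gt0.
pose V := 2^-1 *: C ^+ 2.
(* half of the integrated inequality leaves one spare S, which makes the difference
   definite *)
have pD : posdef (V + S + S - M *m V *m M^T).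
  have [tC _] := posdef_sqr pC.
  have [tD D0] := lyapunov_integrated tC t0 ACB.
  have e : V + S - M *m V *m M^T = 2^-1 *: (C ^+ 2 + 2 *: S - flow_congr A (C ^+ 2) t).
    rewrite /flow_congr -/M /V -scalemxAr -scalemxAl scalerBr scalerDr scalerA.
    by rewrite mulVf ?scale1r ?pnatr_eq0.
  have -> : V + S + S - M *m V *m M^T = S + (V + S - M *m V *m M^T).
    by rewrite addrA (addrC S).
  apply: posdefD => //; rewrite e; split; first by rewrite trmxZ tD.
  by move=> x; rewrite qformZ mulr_ge0// invr_ge0.
have [HT nT] := gauss_rkhs_operator pC HR dM0 pS pD Hf.
have KT : koopman A B t f = fun x => \int[gauss_measure (M *m x) S]_y f y.
  by apply/funext => x; rewrite koopman_gauss.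
rewrite KT; split=> //; apply: (le_trans nT).
rewrite (_ : Num.sqrt _ = expR (t * \tr (- A) / 2))// dM -expRN.
have -> : - (t * \tr A) = t * \tr (- A) / 2 + t * \tr (- A) / 2.
  by rewrite (raddfN (@mxtrace R d)) /=; field.
by rewrite expRD -expr2 sqrtr_sqr ger0_norm ?expR_ge0.
Qed.

End koopman_rkhs.

Theorem theorem2p1 (R : realType) (m d : nat)
    (A : 'M[R]_d) (B : 'M[R]_(d, m)) (C : 'M[R]_d)
    (H : set ('cV[R]_d -> R))
    (ip : ('cV[R]_d -> R) -> ('cV[R]_d -> R) -> R) :
  (0 < m)%N -> (m <= d)%N ->
  hurwitz A -> controllable A B ->
  posdef C ->
  loewner_le (2^-1 *: (A *m C ^+ 2 + C ^+ 2 *m A^T)) (B *m B^T) ->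
  is_rkhs (gauss_kernel C) H ip ->
  forall t : R, 0 <= t ->
    (forall f, H f ->
       H (koopman A B t f) /\
       ip_norm ip (koopman A B t f)
         <= expR (t * \tr (- A) / 2) * ip_norm ip f)
    /\
    (forall f h : 'cV[R]_d -> R, f \in Lfun (stationary A B) 2%:E -> H h ->
       f = h %[ae (stationary A B)] ->
       exists g, [/\ H g, koopman A B t f = g %[ae (stationary A B)] &
         ip_norm ip g <= expR (t * \tr (- A) / 2) * ip_norm ip h]).
Proof.
move=> _ _ _ _ pC ACB HR t t0.
have inv f (Hf : H f) := koopman_rkhs pC ACB HR t0 Hf.
split=> // f h /sub_Lfun_mfun/set_mem/= mf Hh fh.
exists (koopman A B t h); split; [exact: (inv h Hh).1| |exact: (inv h Hh).2].
have mh := measurable_gauss_rkhs pC HR Hh.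
have [t_0|tN0] := eqVneq t 0; first by rewrite t_0 !koopman0.
(* with a singular Sigma the stationary measure is zero and every set is null *)
have [dS|dS] := eqVneq (\det (Sigma A B)) 0.
  by exists setT; split=> //; exact: gauss_measure_singular.
by rewrite (koopman_ae_eq _ _ tN0 dS mf mh fh); exact: ae_eq_refl.
Qed.
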